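(* Let $\mathbb P$ be a separative poset with $S(\mathbb P)=\kappa$. If for some cardinal $\mu\ge|\mathbb P|$ there is a $\kappa$-high Davies tree for $\mu$ over $\mathbb P$, then $\pi\mathrm{nt}(\mathbb P)\le S(\mathbb P)$.
   Context: Posets: $q\le p$ means $q$ extends $p$; $\mathbb P$ is separative if whenever $q\not\le p$ there is $r\le q$ incompatible with $p$. $S(\mathbb P)$ is the least $\kappa$ such that every antichain of $\mathbb P$ has size $<\kappa$. For $\mathbb D\subseteq\mathbb P$, $\mathrm{nt}(\mathbb D)$ is the least cardinal $\kappa$ such that for all $q\in\mathbb P$, $|\{p\in\mathbb D:q\le p\}|<\kappa$; $\pi\mathrm{nt}(\mathbb P)$ is the minimum of $\mathrm{nt}(\mathbb D)$ over dense $\mathbb D\subseteq\mathbb P$. Davies trees: $H_\theta$ is the set of sets hereditarily of size $<\theta$; a set $M$ is $<\!\kappa$-closed if $M^{<\kappa}\subseteq M$. A $\kappa$-high Davies tree for $\mu$ over a set $p$ is a sequence $\langle M_\alpha:\alpha<\mu\rangle$ of elementary submodels of $(H_\theta,\in)$, for some sufficiently large regular $\theta$, such that: (1) for all $\alpha$, $p\in M_\alpha$, $M_\alpha$ is $<\!\kappa$-closed and $|M_\alpha|=\kappa$; (2) $[\mu]^{<\kappa}\subseteq\bigcup_{\alpha<\mu}M_\alpha$; (3) for each $\alpha<\mu$ there is a set $\mathcal N_\alpha$ of elementary submodels of $H_\theta$, $|\mathcal N_\alpha|<\kappa$, each $<\!\kappa$-closed and containing $p$, with $\bigcup_{\xi<\alpha}M_\xi=\bigcup\mathcal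 N_\alpha$. *)

(* Defs.v *)
From HB Require Import structures.
From mathcomp Require Import all_boot boolp classical_sets functions cardinality.
From Stdlib Require Import Relation_Operators.

Set Implicit Arguments.
Unset Strict Implicit.
Unset Printing Implicit Defensive.

Local Open Scope classical_set_scope.
Local Open Scope card_scope.

Declare Scope zf_scope.
Delimit Scope zf_scope with zf.
Reserved Notation "x '∈' y" (at level 70, no associativity).
Reserved Notation "x '⊆' y" (at level 70, no associativity).
Reserved Notation "A '#<' B" (at level 79, format "A  '#<'  B").

Notation "A '#<' B" := ((A #<= B) /\ ~ (B #<= A)) : card_scope.

(** Well-founded trees modulo bisimulation (Aczel's construction).  With the
   classical axioms of [boolp], [V] satisfies the axioms of ZFC, foundation
   included, with separation and replacement for arbitrary predicates and
   functions. *)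

Inductive tree : Type := Tree (A : Type) (f : A -> tree).

Fixpoint bisim (x y : tree) : Prop :=
  let: Tree A f := x in
  let: Tree J g := y in
  (forall i, exists j, bisim (f i) (g j)) /\
  (forall j, exists i, bisim (f i) (g j)).

Lemma bisim_refl x : bisim x x.
Proof. by elim: x => A f IH; split=> i; exists i. Qed.

Lemma bisim_sym x y : bisim x y -> bisim y x.
Proof.
elim: x y => A f IH [J g] /= [fg gf]; split.
- by move=> j; have [i /IH] := gf j; exists i.
- by move=> i; have [j /IH] := fg i; exists j.
Qed.

Lemma bisim_trans x y z : bisim x y -> bisim y z -> bisim x z.
Proof.
elim: x y z => A f IH [J g] [K h] /= [fg gf] [gh hg]; split.
- move=> i; have [j fij] := fg i; have [k gjk] := gh j.
  by exists k; apply: IH fij gjk.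
- move=> k; have [j gjk] := hg k; have [i fij] := gf j.
  by exists i; apply: IH fij gjk.
Qed.

Record V : Type := MkV {
  vclass : set tree;
  vclassP : exists t, vclass = bisim t
}.

Definition vpi (t : tree) : V := MkV (ex_intro _ t erefl).
Definition vrepr (x : V) : tree := projT1 (cid (vclassP x)).

Lemma vreprK x : vpi (vrepr x) = x.
Proof.
rewrite /vrepr; case: cid => t /= e; case: x e => c cP /= e.
by subst c; congr MkV; apply: Prop_irrelevance.
Qed.

Lemma vpiP s t : vpi s = vpi t <-> bisim s t.
Proof.
split=> [[e]|st].
  have : bisim t t by apply: bisim_refl.
  by rewrite -e.
have e : bisim s = bisim t.
  apply/funext => u; apply/propext; split=> h.
    by apply: bisim_trans h; apply: bisim_sym.
  by apply: bisim_trans h.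
rewrite /vpi; move: (ex_intro _ s _) (ex_intro _ t _); rewrite e => p q.
by congr MkV; apply: Prop_irrelevance.
Qed.

HB.instance Definition _ := gen_eqMixin V.
HB.instance Definition _ := gen_choiceMixin V.

Definition vmem (x y : V) : Prop :=
  let: Tree J g := vrepr y in exists j, x = vpi (g j).
Notation "x '∈' y" := (vmem x y) : zf_scope.
Local Open Scope zf_scope.

Definition elts (x : V) : set V := [set y | y ∈ x].
Notation "x '⊆' y" := (elts x `<=` elts y) : zf_scope.

Definition vfam (A : Type) (F : A -> V) : V := vpi (Tree (fun i => vrepr (F i))).

Lemma mem_vfam A (F : A -> V) x : x ∈ vfam F <-> exists i, x = F i.
Proof.
rewrite /vmem; move: (vreprK (vfam F)); rewrite {2}/vfam.
case: (vrepr _) => J g /vpiP /= [gF Fg]; split.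
- by move=> [j ->]; have [i /vpiP ->] := gF j; exists i; rewrite vreprK.
- by move=> [i ->]; have [j /vpiP gj] := Fg i; exists j; rewrite gj vreprK.
Qed.

Lemma vext x y : elts x = elts y -> x = y.
Proof.
rewrite -(vreprK x) -(vreprK y) => e; apply/vpiP.
have {}e z : z ∈ x <-> z ∈ y.
  by move/(congr1 (@^~ z)): e; rewrite !vreprK /elts /= => ->.
move: e; rewrite /vmem; case: (vrepr x) (vrepr y) => A f [J g] e /=; split.
- move=> i; have [|j /vpiP ?] := (e (vpi (f i))).1; first by exists i.
  by exists j.
- move=> j; have [|i /vpiP ?] := (e (vpi (g j))).2; first by exists j.
  by exists i; apply: bisim_sym.
Qed.

Definition vempty : V := vfam (fun i : False => match i with end).
HB.instance Definition _ := isPointed.Build V vempty.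

Definition vpair (x y : V) : V := vfam (fun b : bool => if b then x else y).
Definition opair (x y : V) : V := vpair (vpair x x) (vpair x y).
Definition vimage (F : V -> V) (x : V) : V :=
  let: Tree A f := vrepr x in vfam (fun i : A => F (vpi (f i))).

Lemma mem_vpair z x y : z ∈ vpair x y <-> z = x \/ z = y.
Proof.
rewrite mem_vfam; split=> [[[] ->]|[->|->]]; by [left|right|exists true|exists false].
Qed.

Lemma mem_vimage F x z : z ∈ vimage F x <-> exists2 y, y ∈ x & z = F y.
Proof.
rewrite /vimage /vmem -/(vmem _ _); case: (vrepr x) => A f.
rewrite -/(vmem z (vfam _)) mem_vfam; split.
- by move=> [i ->]; exists (vpi (f i)) => //; exists i.
- by move=> [y [i ->] ->]; exists i.
Qed.

Definition vgraph (x : V) (F : V -> V) : V := vimage (fun i => opair i (F i)) x.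

(** Von Neumann ordinals and cardinals.  Foundation holds in [V], so ordinals are the transitive sets of transitive
   sets; among ordinals, [x <= y] is [x ⊆ y] and [x < y] is [x ∈ y]. *)

Definition transitive_set (x : V) : Prop := forall y, y ∈ x -> y ⊆ x.

Definition ordinal_set (x : V) : Prop :=
  transitive_set x /\ forall y, y ∈ x -> transitive_set y.

Definition cardinal (k : V) : Prop :=
  ordinal_set k /\ forall a, a ∈ k -> ~ (elts a #= elts k).

Definition regular (k : V) : Prop :=
  [/\ cardinal k, infinite_set (elts k) &
      forall X, X ⊆ k -> elts X #< elts k ->
        exists2 b, b ∈ k & forall a, a ∈ X -> a ∈ b].

Definition least_cardinal (Q : set V) : set V :=
  [set k | [/\ cardinal k, Q k & forall l, cardinal l -> Q l -> k ⊆ l]].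

(** Every use below is for a [Q] which holds of some cardinal, so the default
   value of [get] plays no role. *)
Definition min_cardinal (Q : set V) : V := get (least_cardinal Q).

Record poset : Type := Poset {
  carrier : V;
  order : V;
  order_sub : forall z, z ∈ order ->
    exists q p, [/\ q ∈ carrier, p ∈ carrier & z = opair q p];
  order_refl : forall p, p ∈ carrier -> opair p p ∈ order;
  order_anti : forall p q, opair p q ∈ order -> opair q p ∈ order -> p = q;
  order_trans : forall r q p,
    opair r q ∈ order -> opair q p ∈ order -> opair r p ∈ order
}.

Definition poset_set (P : poset) : V := opair (carrier P) (order P).

Section PosetInvariants.
Variable P : poset.

(** [ext q p]: [q] extends [p], written [q <= p] in forcing notation. *)
Definition ext (q p : V) : Prop := opair q p ∈ order P.

Definition incompatible (p q : V) : Prop := ~ exists r, ext r p /\ ext r q.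

Definition separative : Prop :=
  forall q p, q ∈ carrier P -> p ∈ carrier P -> ~ ext q p ->
    exists2 r, ext r q & incompatible r p.

Definition antichain (X : V) : Prop :=
  X ⊆ carrier P /\
  forall p q, p ∈ X -> q ∈ X -> p <> q -> incompatible p q.

Definition dense (D : V) : Prop :=
  D ⊆ carrier P /\
  forall p, p ∈ carrier P -> exists2 d, d ∈ D & ext d p.

Definition souslin : V :=
  min_cardinal [set k | forall X, antichain X -> elts X #< elts k].

Definition nt (D : V) : V :=
  min_cardinal [set k | forall q, q ∈ carrier P ->
    [set p | p ∈ D /\ ext q p] #< elts k].

Definition pint : V :=
  min_cardinal [set k | exists2 D, dense D & nt D = k].

End PosetInvariants.

Inductive formula : Type :=
| FMem (i j : nat)
| FEq (i j : nat)
| FNot (f : formula)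
| FAnd (f g : formula)
| FEx (i : nat) (f : formula).

Definition update (e : nat -> V) (i : nat) (x : V) : nat -> V :=
  fun j => if j == i then x else e j.

Fixpoint sat (D : set V) (e : nat -> V) (f : formula) : Prop :=
  match f with
  | FMem i j => e i ∈ e j
  | FEq i j => e i = e j
  | FNot g => ~ sat D e g
  | FAnd g h => sat D e g /\ sat D e h
  | FEx i g => exists2 x, D x & sat D (update e i x) g
  end.

Definition elementary_submodel (M H : set V) : Prop :=
  [/\ M !=set0, M `<=` H &
      forall f e, (forall i, M (e i)) -> (sat M e f <-> sat H e f)].

Definition trcl (x : V) : set V := [set y | clos_trans V vmem y x].

Definition Hset (theta : V) : set V := [set x | trcl x #< elts theta].

(** [M^{<kappa} ⊆ M], sequences being functions with domain an ordinal. *)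
Definition lt_closed (kappa M : V) : Prop :=
  forall eta F, eta ∈ kappa -> (forall i, i ∈ eta -> F i ∈ M) ->
    vgraph eta F ∈ M.

(** "[theta] is sufficiently large" is read as: the parameters of the notion
   belong to [Hset theta]. *)
Definition davies_tree (kappa mu p : V) (M : V -> V) : Prop :=
  exists theta,
  [/\ regular theta,
      [/\ Hset theta kappa, Hset theta mu & Hset theta p],
      forall a, a ∈ mu ->
        [/\ elementary_submodel (elts (M a)) (Hset theta),
            p ∈ M a, lt_closed kappa (M a) & elts (M a) #= elts kappa],
      forall x, x ⊆ mu -> elts x #< elts kappa ->
        exists2 a, a ∈ mu & x ∈ M a &
      forall a, a ∈ mu -> exists NN : V,
        [/\ forall N, N ∈ NN ->
              [/\ elementary_submodel (elts N) (Hset theta),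
                  lt_closed kappa N & p ∈ N],
            elts NN #< elts kappa &
            forall x, (exists2 xi, xi ∈ a & x ∈ M xi) <->
                      (exists2 N, N ∈ NN & x ∈ N)]].

(* Main.v *)
(** Fix an injection of P into mu and record only the traces on P of the models
   of the tree; nothing else about the tree is used.  (As mu need not belong to
   the models, they need not cover P.)  Since a model of the tree is
   <kappa-closed and has size kappa, a diagonal argument shows that kappa is
   regular and kappa^{<kappa} = kappa.  If B is closed under suitable operations
   on its subsets of size <kappa, then every q has a reduction to B: some r in B
   below all elements of B that lie above q.

   Call p nowhere small if no r <= p has a set of size <kappa dense below it;
   the other p are handled by fewer than kappa conditions, along a maximal
   antichain.  By induction on |B|, every closed B has a subset, dense below its
   nowhere small elements, with fewer than kappa members above any given
   condition.  If |B| <= kappa, pick d_p <= p in B above neither p itself nor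
   any earlier element of B.  Otherwise write B as a union of a well-ordered
   sequence of smaller pieces, the union of each initial segment of which is a
   union of fewer than kappa closed sets; from each piece keep only the chosen
   conditions that lie above no element of an earlier piece.

   To find the pieces: if every smaller subset of B has fewer than |B| subsets
   of size <kappa, take the closures of the initial segments of an enumeration
   of B.  If not, some D of size at most zeta < |B| has at least |B| subsets of
   size <kappa; these code the elements of B, and the tree filters them into
   families of size <= zeta, each of which is the union of fewer than kappa sets
   [D ∩ N]^{<kappa}. *)

Require Import Defs.
From mathcomp Require Import all_boot boolp classical_sets functions cardinality.

Set Implicit Arguments.
Unset Strict Implicit.
Unset Printing Implicit Defensive.

Local Open Scope classical_set_scope.
Local Open Scope card_scope.
Local Open Scope zf_scope.

(** * Cardinal arithmetic along ordinals *)

Lemma choice_ex X Y (R : X -> Y -> Prop) :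
  (forall x, exists y, R x y) -> exists f, forall x, R x (f x).
Proof. by move=> /choice[f fP]; exists f. Qed.

Lemma choice_in X (Y : pointedType) (A : set X) (R : X -> Y -> Prop) :
  (forall x, A x -> exists y, R x y) ->
  exists f, forall x, A x -> R x (f x).
Proof.
move=> ex; apply: (@choice_ex _ _ (fun x y => A x -> R x y)) => x.
by have [/ex[y]|] := pselect (A x); [exists y | exists point].
Qed.

Lemma card_le_inj T U (A : set T) (B : set U) (f : T -> U) :
  (forall x, A x -> B (f x)) ->
  (forall x y, A x -> A y -> f x = f y -> x = y) -> A #<= B.
Proof.
move=> fB finj; suff /injfunPex[g] : exists2 f : T -> U, set_fun A B f & set_inj A f.
  exact: inj_card_le g.
by exists f => // x y /set_mem Ax /set_mem Ay; exact: finj.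
Qed.

Lemma card_le_injE T (U : pointedType) (A : set T) (B : set U) : A #<= B ->
  exists2 f : T -> U, (forall x, A x -> B (f x)) &
    (forall x y, A x -> A y -> f x = f y -> x = y).
Proof.
move=> /pcard_leP/injfunPex[f fB finj]; exists f => // x y Ax Ay.
by apply: finj; rewrite inE.
Qed.

Lemma card_le_surj T U (A : set T) (B : set U) (f : U -> T) :
  (forall x, A x -> exists2 y, B y & f y = x) -> A #<= B.
Proof.
move=> fA; apply: card_le_trans (card_image_le f B).
by apply: subset_card_le => x /fA[y By <-]; exists y.
Qed.

Lemma card_le_surjE T (U : pointedType) (A : set T) (B : set U) (a0 : T) :
  A #<= B -> A a0 ->
  exists2 f : U -> T, (forall y, A (f y)) &
    (forall x, A x -> exists2 y, B y & f y = x).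
Proof.
move=> /card_le_injE[g gB ginj] Aa0.
have [f Hf] : exists f : U -> T,
    forall y, A (f y) /\ ((exists2 x, A x & g x = y) -> g (f y) = y).
  apply: (@choice_ex _ _ (fun y z =>
    A z /\ ((exists2 x, A x & g x = y) -> g z = y))) => y.
  have [[x Ax gx]|nx] := pselect (exists2 x, A x & g x = y).
    by exists x.
  by exists a0; split.
exists f => [y|x Ax]; first by have [] := Hf y.
have [Afx gfx] := Hf (g x); exists (g x); first exact: gB.
by apply: ginj => //; apply: gfx; exists x.
Qed.

(** Recursion along [R] sends each element of [A] to some element of [K] not yet taken by its
    predecessors. The last hypothesis says that the predecessors never exhaust [K]. *)
Lemma wf_card_le T (R : T -> T -> Prop) (U : pointedType) (A : set T)
    (K : set U) : well_founded R ->
  (forall x y, A x -> A y -> [\/ x = y, R x y | R y x]) ->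
  (forall x, A x -> ~ (K #<= [set y | A y /\ R y x])) -> A #<= K.
Proof.
move=> Rwf Rtot nle.
pose G x (rec : forall y, R y x -> U) : U :=
  get [set k | K k /\ forall y (r : R y x), A y -> rec y r <> k].
pose F := Fix Rwf (fun _ => U) G.
have FE x : F x = get [set k | K k /\ forall y, R y x -> A y -> F y <> k].
  rewrite /F Fix_eq // => {}x f g fg; rewrite /G.
  by have -> : f = g by apply/functional_extensionality_dep => y;
    apply/functional_extensionality_dep.
have Fex x : A x -> K (F x) /\ forall y, R y x -> A y -> F y <> F x.
  move=> Ax; rewrite [in K _]FE.
  have H : [set k | K k /\ forall y, R y x -> A y -> F y <> k] (F x).
    rewrite FE; apply: getPex; apply: contrapT => nex; apply: (nle x Ax).
    apply: (@card_le_surj _ _ _ _ F) => k Kk; apply: contrapT => ny.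
    apply: nex; exists k; split=> // y r Ay Fy; apply: ny; by exists y.
  by split; [rewrite -FE; case: H | case: H].
apply: (@card_le_inj _ _ _ _ F) => [x /Fex[]//|x y Ax Ay Fxy].
have [//|r|r] := Rtot x y Ax Ay.
- by have [_ /(_ x r Ax)] := Fex y Ay.
- by have [_ /(_ y r Ay)] := Fex x Ax; rewrite Fxy.
Qed.

(** Hilbert's hotel: shift a copy of the natural numbers inside [A] by one and put [x] in the free
    place. *)
Lemma infinite_setU1_le (T : pointedType) (A : set T) x :
  [set: nat] #<= A -> (A `|` [set x]) #<= A.
Proof.
move=> infA; have [i iA' iinj'] := card_le_injE infA.
have iA n : A (i n) by exact: iA'.
have iinj : injective i by move=> n m; exact: iinj'.
have [Ax|nAx] := pselect (A x).
  by apply: subset_card_le => y [//|->].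
have [g gP] : exists g : T -> T, forall y,
    [/\ y = x -> g y = i 0%N, forall n, y = i n -> g y = i n.+1 &
     y <> x -> (forall n, y <> i n) -> g y = y].
  apply: (@choice_ex _ _ (fun y z => [/\ y = x -> z = i 0%N,
    forall n, y = i n -> z = i n.+1 &
    y <> x -> (forall n, y <> i n) -> z = y])) => y; have [->|yx] := pselect (y = x).
    exists (i 0%N); split=> // n xi; case: nAx; rewrite xi; exact: iA.
  have [[n yi]|ni] := pselect (exists n, y = i n).
    exists (i n.+1); split=> // [m yi'|_ /(_ n)//]; congr (i _.+1).
    by apply: iinj; rewrite -yi.
  by exists y; split=> // n yn; case: ni; exists n.
apply: (@card_le_inj _ _ _ _ g) => [y Ay|y z Ay Az].
  have [gx gi gn] := gP y.
  have [/gx->|yx] := pselect (y = x); first exact: iA.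
  have [[n /gi->]|ni] := pselect (exists n, y = i n); first exact: iA.
  rewrite gn //; last by move=> n yn; case: ni; exists n.
  by case: Ay.
have [gx gi gn] := gP y; have [hx hi hn] := gP z.
have [yx|yx] := pselect (y = x); have [zx|zx] := pselect (z = x).
- by rewrite yx zx.
- rewrite (gx yx); have [[n zn]|nz] := pselect (exists n, z = i n).
    by rewrite (hi n zn) => /iinj.
  rewrite hn // => [iz|n zn]; last by apply: nz; exists n.
  by case: nz; exists 0%N.
- rewrite (hx zx); have [[n yn]|ny] := pselect (exists n, y = i n).
    by rewrite (gi n yn) => /iinj.
  rewrite gn // => [iz|n zn]; last by apply: ny; exists n.
  by case: ny; exists 0%N.
- have [[n yn]|ny] := pselect (exists n, y = i n);
  have [[m zm]|nz] := pselect (exists m, z = i m).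
  + by rewrite (gi n yn) (hi m zm) => /iinj[nm]; rewrite yn zm nm.
  + rewrite (gi n yn) hn // => [iz|k zk]; last by apply: nz; exists k.
    by case: nz; exists n.+1.
  + rewrite gn // => [|k zk]; last by apply: ny; exists k.
    by rewrite (hi m zm) => iz; case: ny; exists m.+1.
  + rewrite gn // => [|k zk]; last by apply: ny; exists k.
    by rewrite hn // => k zk; apply: nz; exists k.
Qed.

(** * Foundation, separation and ordinals in [V] *)

Lemma mem_vpi (y : V) (A : Type) (f : A -> tree) :
  y ∈ vpi (Tree f) <-> exists i, y = vpi (f i).
Proof.
have -> : vpi (Tree f) = vfam (fun i => vpi (f i)).
  apply/vpiP => /=; split=> i; exists i; first apply: bisim_sym;
    by apply/vpiP; rewrite vreprK.
exact: mem_vfam.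
Qed.

Lemma vmem_wf : well_founded vmem.
Proof.
move=> x; rewrite -(vreprK x); elim: (vrepr x) => A f IH.
by constructor=> y /mem_vpi[i ->].
Qed.

Lemma vmem_irr x : ~ x ∈ x.
Proof. by elim/(well_founded_ind vmem_wf): x => x IH xx; apply: (IH x xx). Qed.

Lemma vmem_min (Q : set V) x : Q x ->
  exists2 y, Q y & forall z, z ∈ y -> ~ Q z.
Proof.
elim/(well_founded_ind vmem_wf): x => x IH Qx.
have [[z zx Qz]|nz] := pselect (exists2 z, z ∈ x & Q z); first exact: IH Qz.
by exists x => // z zx Qz; apply: nz; exists z.
Qed.

Lemma vsep_ex x (Q : set V) : exists y, elts y = elts x `&` Q.
Proof.
rewrite -(vreprK x); case: (vrepr x) => A f.
exists (vfam (fun i : {i : A | Q (vpi (f i))} => vpi (f (projT1 i)))).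
apply/seteqP; split=> z.
  by move=> /mem_vfam[[i Qi] ->]; split=> //; apply/mem_vpi; exists i.
move=> [/mem_vpi[i zi] Qz]; apply/mem_vfam.
by rewrite zi in Qz *; exists (exist _ i Qz).
Qed.

Definition vsep x Q : V := projT1 (cid (vsep_ex x Q)).

Lemma elts_vsep x Q : elts (vsep x Q) = elts x `&` Q.
Proof. by rewrite /vsep; case: cid. Qed.

Lemma sub_set_vset x (A : set V) : A `<=` elts x -> elts (vsep x A) = A.
Proof. by move=> Ax; rewrite elts_vsep setIC; apply/setIidPl. Qed.

Lemma ordinal_mem a b : ordinal_set a -> b ∈ a -> ordinal_set b.
Proof.
by move=> [ta aa] ba; split=> [|c cb]; apply: aa => //; apply: ta cb.
Qed.

Lemma ordinal_trans a b c : ordinal_set c -> a ∈ b -> b ∈ c -> a ∈ c.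
Proof. by move=> [tc _] ab /tc; apply. Qed.

Lemma ordinal_trichotomy a b : ordinal_set a -> ordinal_set b ->
  [\/ a = b, a ∈ b | b ∈ a].
Proof.
elim/(well_founded_ind vmem_wf): a b => a IHa.
elim/(well_founded_ind vmem_wf) => b IHb oa ob.
have [[c ca cb]|ab] := pselect (exists2 c, c ∈ a & ~ c ∈ b).
  have [cE|//|bc] := IHa c ca b (ordinal_mem oa ca) ob.
    by apply: Or33; rewrite -cE.
  by apply: Or33; apply: ordinal_trans bc ca.
have [[c cb ca]|ba] := pselect (exists2 c, c ∈ b & ~ c ∈ a).
  have [cE|ac|//] := IHb c cb oa (ordinal_mem ob cb).
    by apply: Or32; rewrite cE.
  by apply: Or32; apply: ordinal_trans ac cb.
apply: Or31; apply: vext; apply/seteqP; split=> c ?; apply: contrapT => ?.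
  by apply: ab; exists c.
by apply: ba; exists c.
Qed.

Lemma ordinal_sub a b : ordinal_set a -> ordinal_set b -> a ⊆ b ->
  a = b \/ a ∈ b.
Proof.
move=> oa ob ab; have [|?|/ab/vmem_irr//] := ordinal_trichotomy oa ob.
  by left.
by right.
Qed.

Lemma ordinal_nmem a b : ordinal_set a -> ordinal_set b -> ~ a ∈ b -> b ⊆ a.
Proof.
move=> oa ob nab; have [->|//|ba] := ordinal_trichotomy oa ob; first by move.
by have [ta _] := oa; apply: ta.
Qed.

Lemma ordinal_vsep a (Q : set V) : ordinal_set a ->
  (forall x y, x ∈ y -> y ∈ a -> Q y -> Q x) -> ordinal_set (vsep a Q).
Proof.
move=> oa Qd; have mE x : x ∈ vsep a Q <-> (x ∈ a /\ Q x).
  by have := elts_vsep a Q; move/seteqP => [h1 h2]; split=> [/h1//|/h2].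
split=> [y /mE[ya Qy] x xy|y /mE[ya _]]; last by have [_] := oa; apply.
by apply/mE; split; [apply: ordinal_trans xy ya | apply: Qd Qy].
Qed.

(** If no [i] in [eta] has as many elements as [K], then [K] is never exhausted along [eta], so
    [wf_card_le] injects [eta] into [K]. This dichotomy is how arbitrary sets are compared with
    ordinals. *)
Lemma ordinal_card_le (eta : V) (U : pointedType) (K : set U) :
  ordinal_set eta ->
  (exists2 i, i ∈ eta & K #<= elts i) \/ elts eta #<= K.
Proof.
move=> oe; have [|nK] := pselect (exists2 i, i ∈ eta & K #<= elts i).
  by left.
right; apply: (wf_card_le vmem_wf) => [x y /(ordinal_mem oe) ox|x xe Kle].
  move=> /(ordinal_mem oe) oy; case: (ordinal_trichotomy ox oy) => ?;
    by [apply: Or31 | apply: Or32 | apply: Or33].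
apply: nK; exists x => //; apply: card_le_trans Kle _.
by apply: subset_card_le => y [].
Qed.

(** * Products and unions of size an infinite ordinal *)

Definition vmax (p : V * V) : V := if `[< p.1 ∈ p.2 >] then p.2 else p.1.

(** Gödel's well-ordering of pairs of ordinals: first by maximum, then lexicographically. *)
Definition goedel (p q : V * V) : Prop :=
  vmax p ∈ vmax q \/
  (vmax p = vmax q /\ (p.1 ∈ q.1 \/ (p.1 = q.1 /\ p.2 ∈ q.2))).

Lemma goedel_wf : well_founded goedel.
Proof.
suff H m a b : vmax (a, b) = m -> Acc goedel (a, b) by move=> [a b]; exact: H.
elim/(well_founded_ind vmem_wf): m a b => m IHm.
elim/(well_founded_ind vmem_wf) => a IHa.
elim/(well_founded_ind vmem_wf) => b IHb mE; constructor=> -[c d] [].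
  by rewrite mE => h; apply: IHm h _ _ _.
rewrite mE => -[cdE /= [ca|[ac db]]]; first exact: IHa ca _ cdE.
by rewrite ac in cdE *; exact: IHb db cdE.
Qed.

Lemma vmax_mem z p : elts z p.1 -> elts z p.2 -> elts z (vmax p).
Proof. by rewrite /vmax; case: ifP. Qed.

Lemma le_vmax p : ordinal_set p.1 -> ordinal_set p.2 ->
  (p.1 ∈ vmax p \/ p.1 = vmax p) /\ (p.2 ∈ vmax p \/ p.2 = vmax p).
Proof.
rewrite /vmax => o1 o2; case: ifP => [/asboolP h|/asboolP h].
  by split; [left|right].
split; first by right.
by have [->|//|?] := ordinal_trichotomy o1 o2; [right|left].
Qed.

Lemma goedel_total z p q : ordinal_set z ->
  (elts z `*` elts z) p -> (elts z `*` elts z) q ->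
  [\/ p = q, goedel p q | goedel q p].
Proof.
move=> oz [p1 p2] [q1 q2].
have om p' : (elts z `*` elts z) p' -> ordinal_set (vmax p').
  by move=> [? ?]; apply: (ordinal_mem oz); apply: vmax_mem.
have [mE|?|?] := ordinal_trichotomy (om p (conj p1 p2)) (om q (conj q1 q2));
  [|by apply: Or32; left|by apply: Or33; left].
have [E1|?|?] := ordinal_trichotomy (ordinal_mem oz p1) (ordinal_mem oz q1);
  [|by apply: Or32; right; split=> //; left
   |by apply: Or33; right; split=> //; left].
have [E2|?|?] := ordinal_trichotomy (ordinal_mem oz p2) (ordinal_mem oz q2);
  [|by apply: Or32; right; split=> //; right
   |by apply: Or33; right; split=> //; right].
by apply: Or31; case: p q E1 E2 {p1 p2 q1 q2 mE} => [? ?] [? ?] /= -> ->.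
Qed.

Lemma card_le_setX T1 T2 (U1 U2 : pointedType) (A1 : set T1) (A2 : set T2)
    (B1 : set U1) (B2 : set U2) :
  A1 #<= B1 -> A2 #<= B2 -> (A1 `*` A2) #<= (B1 `*` B2).
Proof.
move=> /card_le_injE[f fB finj] /card_le_injE[g gB ginj].
apply: (@card_le_inj _ _ _ _ (fun p => (f p.1, g p.2))) => [p [/fB ? /gB ?]//|].
by move=> [a b] [c d] [/= ? ?] [/= ? ?] [/finj-> // /ginj->].
Qed.

Lemma infinite_le T (A : set T) : ~ finite_set A -> [set: nat] #<= A.
Proof. by move=> /infiniteP. Qed.

(** Hessenberg's theorem. By induction, [z] may be assumed not to inject into any of its elements.
    The Gödel predecessors of a pair [p] lie in the square of the successor [E] of [vmax p], which
    by the induction hypothesis is no larger than [vmax p] when that is infinite. *)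
Lemma ordinal_setX_le z : ordinal_set z -> [set: nat] #<= elts z ->
  (elts z `*` elts z) #<= elts z.
Proof.
elim/(well_founded_ind vmem_wf): z => z IH oz infz.
have [[y yz zy]|ny] := pselect (exists2 y, y ∈ z & elts z #<= elts y).
  have yz' : elts y #<= elts z by apply: subset_card_le; apply: oz.1.
  apply: card_le_trans yz'; apply: card_le_trans (card_le_setX zy zy) _.
  apply: IH => //; first exact: ordinal_mem yz.
  exact: card_le_trans zy.
apply: (wf_card_le goedel_wf) => [p q|p zzp zle]; first exact: goedel_total.
have mz : vmax p ∈ z by case: zzp; exact: vmax_mem.
have om := ordinal_mem oz mz.
set E := elts (vmax p) `|` [set vmax p].
have {}zle : elts z #<= (E `*` E).
  apply: card_le_trans zle _; apply: subset_card_le => q [[q1 q2] qp].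
  have [h1 h2] := le_vmax (ordinal_mem oz q1) (ordinal_mem oz q2).
  have mqp : vmax q ∈ vmax p \/ vmax q = vmax p.
    by case: qp => [|[]]; [left|right].
  have qE x : (x ∈ vmax q \/ x = vmax q) -> E x.
    case: mqp => [mqp|->] [xq|->]; [|by left|by left|by right].
    by left; apply: ordinal_trans om xq mqp.
  by split; apply: qE.
have [finm|infm] := pselect (finite_set (elts (vmax p))).
  have finE : finite_set E by rewrite finite_setU; split=> //; exact: finite_set1.
  have := card_le_trans infz zle; apply/finite_setPn.
  exact: finite_setX.
have {}infm := infinite_le infm.
apply: ny; exists (vmax p) => //; apply: card_le_trans zle _.
have Em := infinite_setU1_le (vmax p) infm.
by apply: card_le_trans (card_le_setX Em Em) _; apply: IH.
Qed.

Lemma bigcup_card_le z (T : pointedType) U (I : set T) (G : T -> set U) :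
  ordinal_set z -> [set: nat] #<= elts z -> I #<= elts z ->
  (forall i, I i -> G i #<= elts z) -> \bigcup_(i in I) G i #<= elts z.
Proof.
move=> oz infz Iz Gz; apply: card_le_trans (ordinal_setX_le oz infz).
have [g gz ginj] := card_le_injE Iz.
have [f fP] : exists f : T -> U -> V, forall i, I i ->
    (forall x, G i x -> f i x ∈ z) /\
    (forall x y, G i x -> G i y -> f i x = f i y -> x = y).
  apply: (@choice_in T (U -> V) I (fun i h => (forall x, G i x -> h x ∈ z) /\
    (forall x y, G i x -> G i y -> h x = h y -> x = y))) => i Ii.
  by have [h ? ?] := card_le_injE (Gz i Ii); exists h.
have [k kP] := @choice_in U T (\bigcup_(i in I) G i) (fun u i => I i /\ G i u)
  (fun u '(ex_intro2 i Ii Gu) => ex_intro _ i (conj Ii Gu)).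
apply: (@card_le_inj _ _ _ _ (fun u => (g (k u), f (k u) u))) => [u /kP[Ik Gk]|].
  by split; [exact: gz | exact: (fP _ Ik).1].
move=> u v /kP[Iu Gu] /kP[Iv Gv] [/ginj kE]; have {}kE := kE Iu Iv.
by rewrite -kE in Gv *; apply: (fP _ Iu).2.
Qed.

Lemma setU_card_le z (U : pointedType) (A B : set U) :
  ordinal_set z -> [set: nat] #<= elts z -> A #<= elts z -> B #<= elts z ->
  A `|` B #<= elts z.
Proof.
move=> oz infz Az Bz; rewrite -bigcup2inE.
apply: bigcup_card_le => //.
  by apply: card_le_trans infz; apply: card_leT.
by move=> [|[|[]]].
Qed.

(** * Regularity of kappa *)

Lemma vpair_inj x y z w : vpair x y = vpair z w ->
  (x = z /\ y = w) \/ (x = w /\ y = z).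
Proof.
move=> e; have [xm ym] : x ∈ vpair z w /\ y ∈ vpair z w.
  by rewrite -e !mem_vpair; split; [left|right].
have [zm wm] : z ∈ vpair x y /\ w ∈ vpair x y.
  by rewrite e !mem_vpair; split; [left|right].
move: xm ym zm wm; rewrite !mem_vpair.
by case=> -> [] -> [] ? [] ?; subst; (try by left); right.
Qed.

Lemma opair_inj x y z w : opair x y = opair z w -> x = z /\ y = w.
Proof.
move=> /vpair_inj[[/vpair_inj e1 /vpair_inj e2]|[/vpair_inj e1 /vpair_inj e2]];
  by case: e1 e2 => -[? ?] [] [? ?]; subst.
Qed.

Lemma mem_vgraph w x F : w ∈ vgraph x F <-> exists2 i, i ∈ x & w = opair i (F i).
Proof. exact: mem_vimage. Qed.

Lemma mem_vgraph_opair i z x F : opair i z ∈ vgraph x F <-> i ∈ x /\ z = F i.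
Proof.
rewrite mem_vgraph; split=> [[j jx /opair_inj[-> ->]]//|[ix ->]].
by exists i.
Qed.

Lemma cardinal_mem_lt k i : cardinal k -> i ∈ k -> elts i #< elts k.
Proof.
move=> [ok kP] ik; have ile : elts i #<= elts k by apply: subset_card_le; apply: ok.1.
by split=> // kle; apply: (kP i ik); rewrite card_eq_le ile.
Qed.

Section ClosedCardinal.
Context (kappa : V).

Definition small T (A : set T) : Prop := A #< elts kappa.

Definition pk T (A : set T) : set (set T) := [set x | x `<=` A /\ small x].

Lemma pk_mono T (A B : set T) x : A `<=` B -> pk A x -> pk B x.
Proof. by move=> AB [xA ?]; split=> // z /xA/AB. Qed.

Lemma small_le T U (A : set T) (B : set U) : A #<= B -> small B -> small A.
Proof.
move=> AB [Bk kB]; split; first exact: card_le_trans Bk.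
by move=> kA; apply: kB; apply: card_le_trans AB.
Qed.

Lemma small_image T U (f : T -> U) A : small A -> small (f @` A).
Proof. exact/small_le/card_image_le. Qed.

Lemma small_sub T (A B : set T) : A `<=` B -> small B -> small A.
Proof. by move=> /subset_card_le; apply: small_le. Qed.

(* The last clause makes kappa regular with kappa^{<kappa} = kappa. *)
Definition closed_cardinal : Prop :=
  [/\ cardinal kappa, (exists c, c ∈ kappa /\ exists x, x ∈ c) &
      exists M, lt_closed kappa M /\ elts M #= elts kappa].

Hypothesis hk : closed_cardinal.

Lemma kappa_cardinal : cardinal kappa. Proof. by case: hk. Qed.
Lemma kappa_ordinal : ordinal_set kappa. Proof. by case: kappa_cardinal. Qed.

Lemma kappa_empty : exists2 y, y ∈ kappa & forall z, ~ z ∈ y.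
Proof.
have [_ [c [ck _]] _] := hk.
have [y yk ymin] := @vmem_min (elts kappa) c ck.
by exists y => // z zy; apply: (ymin z) => //; exact: kappa_ordinal.1 zy.
Qed.

(** Starting from the empty sequence, taking the constant sequence of nonzero length [c] over and
    over produces infinitely many distinct elements of [M]. *)
Lemma kappa_infinite : [set: nat] #<= elts kappa.
Proof.
have [_ [c [ck [x0 x0c]]] [M [clM Mk]]] := hk.
move: Mk; rewrite card_eq_le => /andP[Mk _]; apply: card_le_trans Mk.
have [o ok oE] := kappa_empty.
pose u n := iter n (fun x => vgraph c (fun _ => x)) (vgraph o id).
have uS n : u n.+1 = vgraph c (fun _ => u n) by [].
have cS x : opair x0 x ∈ vgraph c (fun _ => x) by apply/mem_vgraph_opair.
have o0 x : vgraph o id <> vgraph c (fun _ => x).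
  move=> e; have := cS x; rewrite -e => /mem_vgraph_opair[+ _].
  exact: oE.
apply: (@card_le_inj _ _ _ _ u) => [n _|n m _ _].
  elim: n => [|n IH]; first by apply: clM => // i /oE.
  by rewrite uS; apply: clM.
elim: n m => [|n IH] [|m] //; rewrite ?uS.
- by move/o0.
- by move/esym/o0.
move=> e; congr S; apply: IH; have := cS (u n); rewrite e.
by move=> /mem_vgraph_opair[].
Qed.

Lemma small_finite T (A : set T) : finite_set A -> small A.
Proof.
move=> finA; have An := finite_set_countable finA.
split; first exact: card_le_trans kappa_infinite.
move=> /(card_le_trans kappa_infinite); exact/finite_setPn.
Qed.

Lemma small1 T (x : T) : small [set x].
Proof. exact/small_finite/finite_set1. Qed.

Lemma small_card_le T (A : set T) : small A -> A #<= elts kappa.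
Proof. by case. Qed.

Lemma smallP (U : pointedType) (A : set U) :
  small A <-> exists2 i, i ∈ kappa & A #<= elts i.
Proof.
split=> [[_ nkA]|[i ik Ai]].
  by have [//|/nkA] := ordinal_card_le A kappa_ordinal.
by apply: small_le Ai _; apply: cardinal_mem_lt => //; exact: kappa_cardinal.
Qed.

Lemma not_small (U : pointedType) (A : set U) : ~ small A -> elts kappa #<= A.
Proof.
by move=> nA; have [/smallP|] := ordinal_card_le A kappa_ordinal.
Qed.

Lemma small_enum (U : pointedType) (A : set U) : small A ->
  exists2 eta, eta ∈ kappa & exists F : V -> U,
    (forall i, i ∈ eta -> A (F i)) /\ 
    (forall a, A a -> exists2 i, i ∈ eta & F i = a).
Proof.
have [[a0 Aa0]|nA] := pselect (A !=set0).
  move=> /smallP[eta etak Aeta]; exists eta => //.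
  by have [F FA AF] := card_le_surjE Aeta Aa0; exists F.
move=> _; have [o ok oE] := kappa_empty; exists o => //.
exists (fun=> point); split=> [i /oE//|a Aa].
by case: nA; exists a.
Qed.

(* Koenig's diagonal argument: a sequence of elements of M indexed by an
   ordinal below kappa belongs to M. *)
Lemma small_bigcup (T U : pointedType) (I : set T) (G : T -> set U) :
  small I -> (forall i, I i -> small (G i)) -> small (\bigcup_(i in I) G i).
Proof.
have [_ _ [M [clM]]] := hk; rewrite card_eq_le => /andP[Mk kM].
move=> /small_enum[eta etak [s [sI Is]]] Gs.
apply: contrapT => /not_small kU.
have [o ok oE] := kappa_empty.
have Mo : elts M (vgraph o id) by apply: clM => // i /oE.
have [g gM Mg] := card_le_surjE (card_le_trans Mk kU) Mo.
pose phi i u := get [set z | opair i z ∈ g u].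
(* [F i] differs from the [i]-th entry [phi i u] of every [g u] with [u] in the [i]-th block, which
   is too small to exhaust [M]. *)
have [|F FP] := @choice_in V V (elts eta)
  (fun i z => z ∈ M /\ forall u, G (s i) u -> phi i u <> z).
- move=> i ieta; apply: contrapT => nz.
  have [_] := Gs _ (sI i ieta); apply; apply: card_le_trans kM _.
  apply: (@card_le_surj _ _ _ _ (phi i)) => z zM; apply: contrapT => nu.
  by apply: nz; exists z; split=> // u Gu uz; apply: nu; exists u.
- have fM : vgraph eta F ∈ M by apply: clM => // i /FP[].
  have [u [i Ii Gu] gu] := Mg _ fM.
  have [k keta sk] := Is i Ii; rewrite -sk in Gu.
  have [_ /(_ u Gu)] := FP k keta; apply; rewrite /phi gu.
  have : opair k (F k) ∈ vgraph eta F by apply/mem_vgraph_opair.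
  move=> h; have := @getI _ [set z | opair k z ∈ vgraph eta F] (F k) h.
  by move=> /mem_vgraph_opair[].
Qed.

Lemma small_setU (U : pointedType) (A B : set U) :
  small A -> small B -> small (A `|` B).
Proof.
move=> sA sB; rewrite -bigcup2inE; apply: small_bigcup.
  exact/small_finite/finite_II.
by move=> [|[|[]]].
Qed.

(** With [A] injected into [M], a small subset of [A] is coded by a sequence enumerating its image.
    This sequence belongs to [M], which has size kappa. *)
Lemma pk_card_le (A : set V) : A #<= elts kappa -> pk A #<= elts kappa.
Proof.
have [_ _ [M [clM]]] := hk; rewrite card_eq_le => /andP[Mk kM] Ak.
apply: card_le_trans Mk.
have [f fM finj] := card_le_injE (card_le_trans Ak kM).
have [|c cP] := @choice_in (set V) V (pk A) (fun x m => m ∈ M /\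
  forall z, A z -> (x z <-> exists i, opair i (f z) ∈ m)).
- move=> x [xA /small_enum[eta etak [F [Fx xF]]]].
  exists (vgraph eta (f \o F)); split.
    by apply: clM => // i /Fx/xA/fM.
  move=> z Az; split=> [/xF[i ieta <-]|[i /mem_vgraph_opair[ieta /finj]]].
    by exists i; apply/mem_vgraph_opair.
  by move=> -> //; [exact: Fx | exact/xA/Fx].
- apply: (@card_le_inj _ _ _ _ c) => [x /cP[]//|x y xA yA cE].
  have [[_ xP] [_ yP]] := (cP x xA, cP y yA).
  have [xA' _] := xA; have [yA' _] := yA.
  apply/seteqP; split=> z xz.
    by apply/(yP z (xA' z xz)); rewrite -cE; apply/xP => //; apply: xA'.
  by apply/(xP z (yA' z xz)); rewrite cE; apply/yP => //; apply: yA'.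
Qed.

Lemma kappa_bigcup (T : pointedType) U (I : set T) (G : T -> set U) :
  I #<= elts kappa -> (forall i, I i -> G i #<= elts kappa) ->
  \bigcup_(i in I) G i #<= elts kappa.
Proof. exact: bigcup_card_le kappa_ordinal kappa_infinite. Qed.

End ClosedCardinal.

(** * Closed submodels and traces of a Davies tree *)

Definition FAll i f := FNot (FEx i (FNot f)).
Definition FImp f g := FNot (FAnd f (FNot g)).

Lemma sat_FAll D e i f :
  sat D e (FAll i f) <-> forall x, D x -> sat D (update e i x) f.
Proof.
split=> [h x Dx|h [x Dx nf]]; last by apply: nf; exact: h.
by apply: contrapT => nf; apply: h; exists x.
Qed.

Lemma sat_FImp D e f g : sat D e (FImp f g) <-> (sat D e f -> sat D e g).
Proof.
split=> [h sf|h [sf ng]]; last by apply: ng; exact: h.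
by apply: contrapT => ng; apply: h.
Qed.

Lemma sat_FAnd D e f g : sat D e (FAnd f g) <-> sat D e f /\ sat D e g.
Proof. by []. Qed.

Definition mem_UU (w f : V) : Prop :=
  exists u v, [/\ u ∈ f, v ∈ u & w ∈ v].

(* The variable 2 belongs to the union of the union of the variable 0. *)
Definition FUU : formula :=
  FEx 3 (FAnd (FMem 3 0) (FEx 4 (FAnd (FMem 4 3) (FMem 2 4)))).

Lemma mem_UU_vgraph w x F :
  mem_UU w (vgraph x F) <-> exists2 i, i ∈ x & w = i \/ w = F i.
Proof.
split=> [[u [v [/mem_vgraph[i ix ->] + wv]]]|[i ix [->|->]]].
- rewrite mem_vpair => -[] vE; rewrite vE mem_vpair in wv; exists i => //;
    by case: wv => ->; auto.
- exists (opair i (F i)), (vpair i i); split; first by apply/mem_vgraph_opair.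
    by apply/mem_vpair; left.
  by apply/mem_vpair; left.
- exists (opair i (F i)), (vpair i (F i)); split; first by apply/mem_vgraph_opair.
    by apply/mem_vpair; right.
  by apply/mem_vpair; right.
Qed.

Lemma Hset_mem theta x y : Hset theta x -> y ∈ x -> Hset theta y.
Proof.
move=> Hx yx; apply: small_sub Hx => z zy.
by apply: Relation_Operators.t_trans zy _; apply: Relation_Operators.t_step.
Qed.

Lemma sat_FUU theta e : Hset theta (e 0%N) ->
  sat (Hset theta) e FUU <-> mem_UU (e 2%N) (e 0%N).
Proof.
move=> H0; rewrite /= /update /=; split.
  by move=> [u _ [uf [v _ [vu wv]]]]; exists u, v.
move=> [u [v [uf vu wv]]]; have Hu := Hset_mem H0 uf.
by exists u => //; split=> //; exists v => //; exact: Hset_mem vu.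
Qed.

Section ClosedSubmodels.
Context (kappa theta : V) (hk : closed_cardinal kappa).
Hypothesis Hkappa : Hset theta kappa.

Definition closed_submodel (M : V) : Prop :=
  elementary_submodel (elts M) (Hset theta) /\ lt_closed kappa M.

(** Induction on [i]: once all elements of [i] are in [M], so is the identity sequence [f] on [i],
    by closure. As [i] is the double union of [f], it is definable from [f], and elementarity puts
    it in [M]. *)
Lemma kappa_sub_closed M : closed_submodel M -> kappa ⊆ M.
Proof.
move=> [[[m Mm] MH Mel] clM]; elim/(well_founded_ind vmem_wf) => i IH ik.
set f := vgraph i id.
have Mf : f ∈ M.
  by apply: clM => // k ki; apply: IH => //; apply: (kappa_ordinal hk).1 ki.
have Hf := MH _ Mf; have Hi := Hset_mem Hkappa ik.
(* The variable 1 has exactly the elements of the double union of [f], the value of the variable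
   0. *)
pose body := FAnd (FAll 2 (FImp (FMem 2 1) FUU)) (FAll 2 (FImp FUU (FMem 2 1))).
have bodyP z : Hset theta z -> sat (Hset theta) (update (fun=> f) 1 z) body <->
    forall w, Hset theta w -> w ∈ z <-> w ∈ i.
  move=> Hz; have UUi w : mem_UU w f <-> w ∈ i.
    by rewrite mem_UU_vgraph; split=> [[k ki [->|->]]//|wi]; exists w => //; left.
  rewrite /body; split=> [/sat_FAnd[/sat_FAll h1 /sat_FAll h2] w Hw|h].
    split=> wz.
      move: (h1 w Hw) => /sat_FImp h1'; apply/UUi.
      by apply/(@sat_FUU theta (update (update (fun=> f) 1 z) 2 w)) => //; apply: h1'.
    move: (h2 w Hw) => /sat_FImp h2'; apply: h2'.
    by apply/sat_FUU => //; apply/UUi.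
  apply/sat_FAnd; split; apply/sat_FAll => w Hw; apply/sat_FImp.
    by move=> /(h w Hw)/UUi wf; apply/sat_FUU.
  by move=> /sat_FUU UU; apply/(h w Hw)/UUi; apply: UU.
have sM : sat (elts M) (fun=> f) (FEx 1 body).
  by apply/Mel => //; exists i => //; apply/bodyP.
case: sM => z Mz sM.
have : sat (Hset theta) (update (fun=> f) 1 z) body.
  by apply/Mel => // k; rewrite /update; case: ifP.
have Hz := MH z Mz; move/(bodyP z Hz) => zi.
suff -> : i = z by [].
apply: vext; apply/seteqP; split=> w wi; apply/zi => //.
  exact: Hset_mem wi.
exact: Hset_mem Hz wi.
Qed.

(** A sequence [f] in [M] enumerates the part of [x] inside [M]. If [x] had an element outside [M],
    it would be missed by the double union of [f]; by elementarity some element of [M] in [x] would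
    be missed too, against the choice of [f]. *)
Lemma small_sub_closed M x : closed_submodel M -> x ∈ M ->
  small kappa (elts x) -> x ⊆ M.
Proof.
move=> hM; have kM := kappa_sub_closed hM.
move: hM => [[_ MH Mel] clM] Mx sx z0 z0x; apply: contrapT => nMz0.
have sxM : small kappa (elts x `&` elts M) by apply: small_sub sx => ? [].
have [eta etak [F [FxM xMF]]] := small_enum hk sxM.
set f := vgraph eta F.
have Mf : f ∈ M by apply: clM => // i /FxM[].
have Hf := MH _ Mf; have Hx := MH _ Mx.
(* The set [x] is the value of the variable 5, which does not occur in [FUU]. *)
pose e n := if n == 5 then x else f.
have Me n : e n ∈ M by rewrite /e; case: ifP.
pose body := FAnd (FMem 2 5) (FNot FUU).
have bodyP z : sat (Hset theta) (update e 2 z) body <-> z ∈ x /\ ~ mem_UU z f.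
  split=> [[zx nUU]|[zx nUU]]; split=> //.
    by move=> UU; apply: nUU; apply/sat_FUU.
  by move=> /sat_FUU UU; apply: nUU; apply: UU.
have : sat (elts M) e (FEx 2 body).
  apply/Mel => //; exists z0; first exact: (Hset_mem Hx z0x).
  apply/bodyP; split=> // /mem_UU_vgraph[i ieta [] z0E]; apply: nMz0; rewrite z0E.
    by apply: kM; apply: ordinal_trans ieta etak; exact: kappa_ordinal.
  by have [] := FxM i ieta.
case=> z Mz sM.
have : sat (Hset theta) (update e 2 z) body.
  apply/Mel => // k; rewrite /update; case: (k == 2) => //; exact: Me.
move/bodyP=> [zx]; apply; apply/mem_UU_vgraph.
by have [i ieta <-] := xMF z (conj zx Mz); exists i => //; right.
Qed.

(** A sequence enumerating [x] is a single element from which every closed model recovers all of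
    [x]. It turns equality of two unions of models into agreement on which small sets are included
    in one of the models. *)
Lemma closed_submodel_code M (x : set V) : closed_submodel M ->
  small kappa x -> x `<=` elts M ->
  exists2 f, f ∈ M & forall N, closed_submodel N -> f ∈ N -> x `<=` elts N.
Proof.
move=> [_ clM] /(small_enum hk)[eta etak [F [Fx xF]]] xM.
exists (vgraph eta F); first by apply: clM => // i /Fx/xM.
move=> N hN fN z /xF[i ieta <-].
have pairN u v : vpair u v ∈ N -> u ∈ N /\ v ∈ N.
  move=> uvN; have suv : small kappa (elts (vpair u v)).
    apply: (@small_sub _ _ _ [set u; v]) => [w /mem_vpair//|].
    exact/(small_finite hk)/finite_set2.
  by split; apply: (small_sub_closed hN uvN) => //; apply/mem_vpair; [left|right].
have oN : opair i (F i) ∈ N.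
  apply: (small_sub_closed hN fN); last by apply/mem_vgraph_opair.
  apply: (@small_sub _ _ _ ((fun k => opair k (F k)) @` elts eta)).
    by move=> w /mem_vgraph[k keta ->]; exists k.
  apply: small_image; apply: cardinal_mem_lt etak; exact: kappa_cardinal.
by have [_ /pairN[]] := pairN _ _ oN.
Qed.

End ClosedSubmodels.

(* The clauses of [davies_tree] for the traces [A a] on X of the models, X being
   identified with a subset of mu. *)
Definition davies_trace (kappa mu : V) (X : set V) (A : V -> set V) : Prop :=
  [/\ forall a, a ∈ mu -> A a #<= elts kappa,
      forall x, pk kappa X x -> exists2 a, a ∈ mu & x `<=` A a &
      forall a, a ∈ mu -> exists (NN : set V) (B : V -> set V),
        small kappa NN /\ forall x, pk kappa X x ->
          ((exists2 xi, xi ∈ a & x `<=` A xi) <-> (exists2 n, NN n & x `<=` B n))].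

Lemma davies_tree_trace kappa mu p M X :
  closed_cardinal kappa -> cardinal mu -> X #<= elts mu ->
  davies_tree kappa mu p M -> exists A, davies_trace kappa mu X A.
Proof.
move=> hk mu_card /card_le_injE[j jmu jinj].
move=> [theta [_ [Hkappa Hmu _] Mcl Mcov Minit]].
pose A a := [set p | X p /\ j p ∈ M a].
have Mcl' a : a ∈ mu -> closed_submodel kappa theta (M a).
  by move=> /Mcl[].
exists A; split.
- move=> a /Mcl[_ _ _]; rewrite card_eq_le => /andP[Mk _].
  apply: card_le_trans Mk; apply: (@card_le_inj _ _ _ _ j) => [x []//|].
  by move=> x y [Xx _] [Xy _]; exact: jinj.
- move=> x [xX sx].
  have jxmu : j @` x `<=` elts mu by move=> _ [z /xX/jmu ? <-].
  have xE := sub_set_vset jxmu; set y := vsep mu _ in xE.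
  have sy : small kappa (elts y) by rewrite xE; apply: small_image.
  have [|a amu ya] := Mcov y _ sy; first by rewrite xE.
  exists a => // z xz; split; first exact: xX.
  apply: (small_sub_closed hk Hkappa (Mcl' a amu) ya sy).
  by rewrite xE; exists z.
- move=> a amu; have [NN [NNcl sNN NNE]] := Minit a amu.
  have NNcl' N : N ∈ NN -> closed_submodel kappa theta N by move=> /NNcl[].
  exists (elts NN), (fun N => [set p | X p /\ j p ∈ N]); split=> // x [xX sx].
  have sjx : small kappa (j @` x) by apply: small_image.
  have sub N : x `<=` [set p | X p /\ j p ∈ N] <-> j @` x `<=` elts N.
    split=> [h _ [z /h[_ ?] <-]//|h z xz]; split; first exact: xX.
    by apply: h; exists z.
  have xi_mu xi : xi ∈ a -> xi ∈ mu by move=> h; apply: mu_card.1.1 h.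
  split=> [[xi xia /sub xxi]|[N NNN /sub xN]].
    have [f fM fN] := closed_submodel_code hk Hkappa (Mcl' xi (xi_mu xi xia)) sjx xxi.
    have [|N NNN fN'] := (NNE f).1; first by exists xi.
    by exists N => //; apply/sub; apply: fN => //; exact: NNcl'.
  have [f fN fM] := closed_submodel_code hk Hkappa (NNcl' N NNN) sjx xN.
  have [|xi xia fxi] := (NNE f).2; first by exists N.
  by exists xi => //; apply/sub; apply: fM => //; apply: Mcl'; exact: xi_mu.
Qed.

(** * Closure under operations on small sets *)

Section Closure.
Context (kappa : V) (hk : closed_cardinal kappa).

(** Regularity of kappa: the successors of the elements of [I] have a small union, which therefore
    omits some element of kappa. *)
Lemma kappa_bounded (I : set V) : small kappa I -> I `<=` elts kappa ->
  exists2 k, k ∈ kappa & forall i, I i -> i ∈ k.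
Proof.
move=> sI Ik; apply: contrapT => nk.
have ok := kappa_ordinal hk.
have sU : small kappa (\bigcup_(i in I) (elts i `|` [set i])).
  apply: small_bigcup => // i Ii; apply: small_setU => //; last exact: small1.
  apply: cardinal_mem_lt; [exact: kappa_cardinal | exact: Ik].
apply: sU.2; apply: subset_card_le => k kk; apply: contrapT => nU.
apply: nk; exists k => // i Ii.
have [iE|//|ki] := ordinal_trichotomy (ordinal_mem ok (Ik i Ii)) (ordinal_mem ok kk).
  by case: nU; exists i => //; right.
by case: nU; exists i => //; left.
Qed.

Context (F : set V -> set V).

Definition closed_under (Z : set V) : Prop :=
  forall y, pk kappa Z y -> F y `<=` Z.

Definition cl (Z : set V) : set V :=
  [set b | forall W, Z `<=` W -> closed_under W -> W b].

Lemma sub_cl Z : Z `<=` cl Z.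
Proof. by move=> b Zb W ZW _; exact: ZW. Qed.

Lemma closed_cl Z : closed_under (cl Z).
Proof.
move=> y [ycl sy] b Fb W ZW Wcl; apply: (Wcl y) => //; split=> // c yc.
exact: ycl.
Qed.

Lemma cl_min Z W : Z `<=` W -> closed_under W -> cl Z `<=` W.
Proof. by move=> ZW Wcl b; apply. Qed.

Lemma cl_mono Z W : Z `<=` W -> cl Z `<=` cl W.
Proof.
by move=> ZW; apply: cl_min (@closed_cl W); apply: subset_trans ZW (@sub_cl W).
Qed.

(** The union [W] of the closures of small subsets of [Z] is already closed, because a small union
    of small sets is small. *)
Lemma cl_pk Z z : pk kappa (cl Z) z -> exists2 y, pk kappa Z y & z `<=` cl y.
Proof.
pose W := [set b | exists2 y, pk kappa Z y & cl y b].
have pick x : pk kappa W x -> exists2 y, pk kappa Z y & x `<=` cl y.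
  move=> [xW sx].
  have [|g gP] := @choice_in V (set V) x (fun b y => pk kappa Z y /\ cl y b).
    by move=> b /xW[y ? ?]; exists y.
  exists (\bigcup_(b in x) g b).
    split=> [c [b /gP[[gZ _] _]]|]; first exact: gZ.
    by apply: small_bigcup => // b /gP[[]].
  move=> b xb; have [_ gb] := gP b xb.
  by apply: cl_mono gb => c gc; exists b.
have ZW : Z `<=` W.
  move=> b Zb; exists [set b]; last exact: sub_cl.
  by split=> [c ->//|]; exact: small1.
have Wcl : closed_under W.
  move=> x xW b Fb; have [y yZ xy] := pick x xW; exists y => //.
  by apply: (@closed_cl y x) => //; split=> //; case: xW.
move=> [zcl sz]; apply: pick; split=> // b /zcl; exact: cl_min.
Qed.

Hypothesis F_card : forall y, small kappa y -> F y #<= elts kappa.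

(** The [i]-th iterate in the construction of the closure from below. *)
Inductive stage (Z : set V) (i b : V) : Prop :=
| Stage0 of Z b
| StageS j y of j ∈ i & small kappa y & (forall c, y c -> stage Z j c) & F y b.

Lemma stage_mono Z j k : ordinal_set k -> j ∈ k -> stage Z j `<=` stage Z k.
Proof.
move=> okk jk b [Zb|l y lj sy yl Fb]; first exact: Stage0.
by apply: (@StageS Z k b l y) => //; exact: (ordinal_trans okk lj jk).
Qed.

(** The construction from below stops after kappa stages by regularity, and each stage has at most
    kappa elements because a set of size at most kappa has at most kappa small subsets. *)
Lemma cl_card_le_kappa Z : Z #<= elts kappa -> cl Z #<= elts kappa.
Proof.
move=> Zk; have ok := kappa_ordinal hk.
have stage_card i : i ∈ kappa -> stage Z i #<= elts kappa.
  elim/(well_founded_ind vmem_wf): i => i IH ik.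
  apply: (@card_le_trans _ _ _
    (Z `|` \bigcup_(j in elts i) \bigcup_(y in pk kappa (stage Z j)) F y)).
    apply: subset_card_le => b [Zb|j y ji sy yj Fb]; first by left.
    by right; exists j => //; exists y.
  apply: setU_card_le => //; first exact: kappa_infinite.
  apply: kappa_bigcup => // [|j ji].
    by apply: subset_card_le; apply: ok.1.
  apply: kappa_bigcup => // [|y [_ sy]]; last exact: F_card.
  by apply: pk_card_le => //; apply: IH => //; apply: ordinal_trans ji ik.
apply: (@card_le_trans _ _ _ (\bigcup_(i in elts kappa) stage Z i)); last first.
  exact: kappa_bigcup.
apply: subset_card_le; apply: cl_min => [b Zb|y [yW sy] b Fb].
  by have [o ok' _] := kappa_empty hk; exists o => //; exact: Stage0.
have [|g gP] := @choice_in V V y (fun c i => i ∈ kappa /\ stage Z i c).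
  by move=> c /yW[i ? ?]; exists i.
have [|_ [c /gP[? _] <-]|k kk gk] := @kappa_bounded (g @` y) => //.
  exact: small_image.
(* All members of [y] have appeared by stage [k], so [F y] is added at any later stage [l]. *)
have [|_ ->|l lk kl] := @kappa_bounded [set k] => //.
  exact: small1.
exists l => //; apply: (@StageS _ _ _ k y) => //; first exact: kl.
move=> c yc; have [gck] := gP c yc; apply: stage_mono.
  exact: ordinal_mem kk.
by apply: gk; exists c.
Qed.

Lemma cl_card_le zeta Z : ordinal_set zeta -> elts kappa #<= elts zeta ->
  pk kappa Z #<= elts zeta -> cl Z #<= elts zeta.
Proof.
move=> oz kz pz.
apply: (@card_le_trans _ _ _ (\bigcup_(y in pk kappa Z) cl y)).
  apply: subset_card_le => b clb.
  have [|y yZ yb] := @cl_pk Z [set b].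
    by split=> [c ->//|]; exact: small1.
  by exists y => //; apply: yb.
apply: bigcup_card_le => // [|y [_ [yk _]]].
  exact: card_le_trans (kappa_infinite hk) kz.
by apply: card_le_trans kz; apply: cl_card_le_kappa.
Qed.

End Closure.

(** * Locally small dense sets *)

Section Forcing.
Context (kappa : V) (hk : closed_cardinal kappa) (P : poset).
Hypothesis hP : separative P.
Hypothesis hS : forall X, antichain P X -> small kappa (elts X).

Let C := elts (carrier P).

Lemma ext_carrier q p : ext P q p -> C q /\ C p.
Proof.
by move=> /(@order_sub P)[q' [p' [q'C p'C /opair_inj[-> ->]]]].
Qed.

Lemma ext_refl p : C p -> ext P p p.
Proof. exact: order_refl. Qed.

Lemma ext_trans r q p : ext P r q -> ext P q p -> ext P r p.
Proof. exact: order_trans. Qed.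

Lemma incompatible_sym p q : incompatible P p q -> incompatible P q p.
Proof. by move=> pq [r [? ?]]; apply: pq; exists r. Qed.

Lemma max_antichain (E : set V) : E `<=` C ->
  exists A, [/\ A `<=` E, small kappa A &
    forall e, E e -> exists2 a, A a & ~ incompatible P e a].
Proof.
move=> EC.
pose Q (A : set V) := A `<=` E /\
  forall p q, A p -> A q -> p <> q -> incompatible P p q.
have [G GQ totG|A [[AE Ainc] Amax]] := @Zorn_bigcup V Q.
  split=> [p [A /GQ[AE _]]|p q [A GA Ap] [B GB Bq]]; first exact: AE.
  by have [AB|BA] := totG A B GA GB;
    [have [_] := GQ B GB | have [_] := GQ A GA]; apply; auto.
exists A; split=> //.
  have AC : A `<=` C by apply: subset_trans EC.
  have AX := sub_set_vset AC; rewrite -AX; apply: hS; set X := vsep _ _ in AX *.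
  have memX p : p ∈ X -> A p by rewrite -AX.
  by split=> [p /memX/AC//|p q /memX Ap /memX Aq]; exact: Ainc.
move=> e Ee; apply: contrapT => ne.
have {}ne a : A a -> incompatible P e a.
  by move=> Aa; apply: contrapT => ?; apply: ne; exists a.
apply: (Amax (A `|` [set e])).
  split=> [|sub]; first by left.
  have /ne : A e by apply: sub; right.
  by apply; exists e; split; apply: ext_refl; exact: EC.
split=> [p [/AE//|->//]|p q [Ap|->] [Aq|->]] //.
- exact: Ainc.
- by move=> _; apply: incompatible_sym; exact: ne.
- by move=> _; exact: ne.
Qed.

Definition separator p q : V := get [set s | ext P s p /\ incompatible P s q].
Definition stranger (y : set V) : V :=
  get [set q | C q /\ forall a, y a -> incompatible P q a].
Definition avoider p (y : set V) : V :=
  get [set d | ext P d p /\ forall a, y a -> ~ ext P a d].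

(** The witnesses a closed set must contain for reductions and for the choice of conditions to be
    carried out inside it. Intersecting with [C] discards the default values taken when no witness
    exists. *)
Definition forcing_op (y : set V) : set V :=
  C `&` ([set stranger y] `|` (\bigcup_(p in y) [set avoider p y]) `|`
    \bigcup_(p in y) \bigcup_(q in y) [set separator p q]).

Lemma forcing_op_card y : small kappa y -> forcing_op y #<= elts kappa.
Proof.
move=> [yk _]; have ok := kappa_ordinal hk; have infk := kappa_infinite hk.
have k1 (x : V) : [set x] #<= elts kappa.
  by have [] := small1 hk x.
apply: card_le_trans (subset_card_le (@subIsetr _ _ _)) _.
apply: setU_card_le => //; last first.
  by apply: kappa_bigcup => // p _; apply: kappa_bigcup.
by apply: setU_card_le => //; apply: kappa_bigcup.
Qed.

Definition forcing_closed (B : set V) : Prop :=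
  B `<=` C /\ closed_under kappa forcing_op B.

Lemma forcing_closed_carrier : forcing_closed C.
Proof. by split=> // y _ b []. Qed.

Lemma forcing_closed_cl Z : Z `<=` C -> forcing_closed (cl kappa forcing_op Z).
Proof.
move=> ZC; split; last exact: closed_cl.
by apply: cl_min => // y _ b [].
Qed.

Lemma closed_separator B p q : forcing_closed B -> B p -> B q -> ~ ext P p q ->
  exists s, [/\ B s, ext P s p & incompatible P s q].
Proof.
move=> [BC Bcl] Bp Bq npq.
have [s0 s0p s0q] := hP (BC p Bp) (BC q Bq) npq.
have [sp sq] : ext P (separator p q) p /\ incompatible P (separator p q) q.
  exact: (@getI _ [set s | ext P s p /\ incompatible P s q] s0).
exists (separator p q); split=> //.
apply: (Bcl [set p; q]).
  by split=> [x [->|->]//|]; exact/(small_finite hk)/finite_set2.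
split; first by have [] := ext_carrier sp.
by right; exists p; [left|exists q; [right|]].
Qed.

Lemma closed_stranger B y : forcing_closed B -> pk kappa B y ->
  (exists2 q, C q & forall a, y a -> incompatible P q a) ->
  exists2 q, B q & forall a, y a -> incompatible P q a.
Proof.
move=> [BC Bcl] yB [q0 Cq0 q0y].
have [Cq qy] : C (stranger y) /\ forall a, y a -> incompatible P (stranger y) a.
  exact: (@getI _ [set q | C q /\ forall a, y a -> incompatible P q a] q0).
exists (stranger y) => //; apply: (Bcl y yB); split=> //.
by left; left.
Qed.

Lemma closed_avoider B p y : forcing_closed B -> pk kappa B y -> y p ->
  (exists2 d, ext P d p & forall a, y a -> ~ ext P a d) ->
  exists d, [/\ B d, ext P d p & forall a, y a -> ~ ext P a d].
Proof.
move=> [BC Bcl] yB yp [d0 d0p d0y].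
have [dp dy] : ext P (avoider p y) p /\ forall a, y a -> ~ ext P a (avoider p y).
  exact: (@getI _ [set d | ext P d p /\ forall a, y a -> ~ ext P a d] d0).
exists (avoider p y); split=> //; apply: (Bcl y yB); split.
  by have [] := ext_carrier dp.
by left; right; exists p.
Qed.

Definition reductive (B : set V) : Prop := forall q, C q ->
  exists2 r, B r & forall p, B p -> ext P q p -> ext P r p.

(** First find [r] in [B] all of whose extensions in [B] are compatible with [q]: otherwise an
    element of [B] incompatible with every member of a maximal antichain of elements of [B]
    incompatible with [q] leads to a contradiction. If such an [r] were not below some [p] in [B]
    above [q], a separator in [B] below [r] and incompatible with [p] would still be compatible with
    [q]. *)
Lemma closed_reductive B : forcing_closed B -> reductive B.
Proof.
move=> Bcl; have [BC _] := Bcl => q Cq.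
have [r Br rP] : exists2 r, B r & forall r', B r' -> ext P r' r ->
    ~ incompatible P r' q.
  apply: contrapT => nr.
  pose E := [set r | B r /\ incompatible P r q].
  have [r [/BC//]|A [AE sA Amax]] := @max_antichain E.
  have [||r Br rA] := @closed_stranger B A Bcl.
  - by split=> // r /AE[].
  - exists q => // a /AE[_]; exact: incompatible_sym.
  apply: nr; exists r => // r' Br' r'r r'q.
  have [a Aa] := Amax r' (conj Br' r'q); apply => -[s [sr' sa]].
  by apply: (rA a Aa); exists s; split=> //; apply: ext_trans r'r.
exists r => // p Bp qp; apply: contrapT => nrp.
have [s [Bs sr sp]] := closed_separator Bcl Br Bp nrp.
apply: (rP s Bs sr) => -[t [ts tq]].
by apply: sp; exists t; split=> //; apply: ext_trans qp.
Qed.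

(** * Nowhere small conditions and sparse subsets *)

Definition small_density p : Prop :=
  exists2 E : set V, small kappa E /\ E `<=` C &
    forall s, ext P s p -> exists2 e, E e & ext P e s.

Definition nowhere_small p : Prop := forall r, ext P r p -> ~ small_density r.

Lemma nowhere_small_ext p r : nowhere_small p -> ext P r p -> nowhere_small r.
Proof. by move=> np rp s sr; apply: np; apply: ext_trans rp. Qed.

Lemma nowhere_small_avoid p y : C p -> nowhere_small p -> small kappa y ->
  exists2 d, ext P d p & forall a, y a -> ~ ext P a d.
Proof.
move=> Cp np sy; apply: contrapT => nd; apply: (np p (ext_refl Cp)).
exists (y `&` C); first by split=> //; apply: small_sub sy => ? [].
move=> s sp; apply: contrapT => ne; apply: nd; exists s => // a ya ae.
by apply: ne; exists a => //; split=> //; have [] := ext_carrier ae.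
Qed.

(** The bound is asked only for [q] in [X]; for conditions of later pieces it is obtained through
    reductions. *)
Definition sparse_dense (X : set V) : Prop := exists2 D : set V, D `<=` X &
  (forall p, X p -> nowhere_small p -> exists2 d, D d & ext P d p) /\
  (forall q, X q -> small kappa [set d | D d /\ ext P q d]).

Definition reductive_union (Y : set V) : Prop :=
  exists (I : set V) (G : V -> set V),
    [/\ small kappa I, forall n, I n -> reductive (G n) &
        Y = \bigcup_(n in I) G n].

(** By the choice of [d p], a condition [q] of [B] can extend [d p] only if [p] comes before [q],
    and [q] has fewer than kappa predecessors. *)
Lemma sparse_dense_kappa B : forcing_closed B -> B #<= elts kappa ->
  sparse_dense B.
Proof.
move=> Bcl /card_le_injE[f fk finj]; have [BC _] := Bcl.
have ok := kappa_ordinal hk.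
have small_below p : B p -> small kappa [set q | B q /\ (f q ∈ f p \/ q = p)].
  move=> Bp; apply: (@small_sub _ _ _ ([set q | B q /\ f q ∈ f p] `|` [set p])).
    by move=> q [Bq [|->]]; [left|right].
  apply: small_setU (small1 hk p) => //.
  apply: small_le (cardinal_mem_lt (kappa_cardinal hk) (fk p Bp)).
  apply: (@card_le_inj _ _ _ _ f) => [q []//|q r [Bq _] [Br _]]; exact: finj.
have [|d dP] := @choice_in V V [set p | B p /\ nowhere_small p]
  (fun p d => [/\ B d, ext P d p &
     forall q, B q -> f q ∈ f p \/ q = p -> ~ ext P q d]).
  move=> p [Bp np].
  have [|||d [Bd dp dy]] :=
      @closed_avoider B p [set q | B q /\ (f q ∈ f p \/ q = p)] Bcl.
  - by split; [move=> q [] | exact: small_below].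
  - by split=> //; right.
  - by apply: nowhere_small_avoid (small_below p Bp) => //; exact: BC.
  by exists d; split=> // q Bq qp; apply: dy.
exists (d @` [set p | B p /\ nowhere_small p]) => [_ [p /dP[? _ _] <-]//|].
split=> [p Bp np|q Bq].
  by have [_ ? _] := dP p (conj Bp np); exists (d p) => //; exists p.
apply: small_sub (small_image d (small_below q Bq)).
move=> _ [[p Xp <-] qd]; have [_ _ dq] := dP p Xp; have [Bp _] := Xp.
exists p => //; split=> //.
have [E|qp|pq] := ordinal_trichotomy (ordinal_mem ok (fk q Bq)) (ordinal_mem ok (fk p Bp)).
- by right; apply: finj.
- by case: (dq q Bq _ qd); left.
- by left.
Qed.

(** Only chosen conditions with no extension in an earlier piece are kept. Density survives by
    passing to the least piece meeting the extensions of [p]. For [q] in piece [xi], kept conditions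
    above [q] from later pieces do not exist, and those from earlier pieces lie above one of the
    small number of reductions of [q], to which the induction hypothesis applies. *)
Lemma sparse_dense_concat tau (J : set V) (X : V -> set V) :
  ordinal_set tau -> J `<=` elts tau -> (forall i, J i -> X i `<=` C) ->
  (forall i, J i -> sparse_dense (X i)) ->
  (forall i, J i -> reductive_union (\bigcup_(k in J `&` elts i) X k)) ->
  sparse_dense (\bigcup_(i in J) X i).
Proof.
move=> ot Jt XC Xsd Yru.
pose Y i := \bigcup_(k in J `&` elts i) X k.
have [|D DP] := @choice_in V (set V) J (fun i D => D `<=` X i /\
  ((forall p, X i p -> nowhere_small p -> exists2 d, D d & ext P d p) /\
   (forall q, X i q -> small kappa [set d | D d /\ ext P q d]))).
  by move=> i /Xsd[D ? ?]; exists D.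
exists [set d | exists2 i, J i & D i d /\ forall r, Y i r -> ~ ext P r d].
  by move=> d [i Ji [Dd _]]; exists i => //; have [DX _] := DP i Ji; apply: DX.
split=> [p [i0 Ji0 Xp] np|q [xi Jxi Xq]].
  have [i [Ji [r Xr rp]] imin] :=
    @vmem_min [set i | J i /\ exists2 r, X i r & ext P r p] i0
      (conj Ji0 (ex_intro2 _ (fun r => ext P r p) p Xp (ext_refl (XC i0 Ji0 p Xp)))).
  have [_ [Ddense _]] := DP i Ji.
  have [d Dd dr] := Ddense r Xr (nowhere_small_ext np rp).
  exists d; last exact: ext_trans rp.
  exists i => //; split=> // s [k [Jk ki] Xs] sd; apply: (imin k ki).
  by split=> //; exists s => //; apply: ext_trans sd (ext_trans dr rp).
elim/(well_founded_ind vmem_wf): xi q Jxi Xq => xi IH q Jxi Xq.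
have [I [G [sI Gred YG]]] := Yru xi Jxi.
have Cq := XC xi Jxi q Xq.
have [|r rP] := @choice_in V V I (fun n r => G n r /\
    forall p, G n p -> ext P q p -> ext P r p).
  by move=> n /Gred /(_ q Cq)[r ? ?]; exists r.
set DD := [set d | exists2 i, J i & D i d /\ forall r, Y i r -> ~ ext P r d].
apply: (@small_sub _ _ _ ([set d | D xi d /\ ext P q d] `|`
    \bigcup_(n in I) [set d | DD d /\ ext P (r n) d])).
  move=> d [DDd qd]; have [i Ji [Dd dY]] := DDd.
  have [iE|ix|xi_i] := ordinal_trichotomy (ordinal_mem ot (Jt i Ji))
    (ordinal_mem ot (Jt xi Jxi)).
  - by left; rewrite -iE.
  - right; have : Y xi d.
      by exists i => //; have [DX _] := DP i Ji; exact: DX.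
    rewrite /Y YG => -[n In Gd]; exists n => //; split=> //.
    by have [_ h] := rP n In; apply: h.
  - by case: (dY q) => //; exists xi.
apply: small_setU => //; first by have [_ [_ h]] := DP xi Jxi; apply: h.
apply: small_bigcup => // n In; have [Gr _] := rP n In.
have : Y xi (r n) by rewrite /Y YG; exists n.
by move=> [k [Jk kxi] Xk]; apply: (IH k).
Qed.

(** Once the pieces are well-ordered by an injection into kappa, the union of every initial segment
    is itself a small union of reductive pieces. *)
Lemma sparse_dense_small (I : set V) (X : V -> set V) : small kappa I ->
  (forall n, I n -> X n `<=` C) -> (forall n, I n -> reductive (X n)) ->
  (forall n, I n -> sparse_dense (X n)) -> sparse_dense (\bigcup_(n in I) X n).
Proof.
move=> sI XC Xred Xsd.
have [f fk finj] := card_le_injE (small_card_le sI).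
have [|g gP] := @choice_in V V (f @` I) (fun i n => I n /\ f n = i).
  by move=> _ [n In <-]; exists n.
have gf n : I n -> g (f n) = n.
  by move=> In; have [|Ig fg] := gP (f n); [exists n | exact: finj].
have -> : \bigcup_(n in I) X n = \bigcup_(i in f @` I) X (g i).
  apply/seteqP; split=> b [n In Xn]; last by exists (g n) => //; have [] := gP n In.
  by exists (f n); [exists n | rewrite gf].
apply: (sparse_dense_concat (kappa_ordinal hk)).
- by move=> _ [n In <-]; exact: fk.
- by move=> i /gP[+ _]; exact: XC.
- by move=> i /gP[+ _]; exact: Xsd.
- move=> i _; exists (f @` I `&` elts i), (X \o g); split=> //.
    by apply: small_sub (small_image f sI) => ? [].
  by move=> k [/gP[+ _] _]; exact: Xred.
Qed.

Lemma sparse_dense_total : sparse_dense C -> exists2 D, dense P D &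
  forall q, C q -> small kappa [set d | d ∈ D /\ ext P q d].
Proof.
move=> [D1 D1C [D1d D1s]].
(* Conditions that are not nowhere small have an extension compatible with a member of this
   antichain; the small dense sets below its members together form the small set [D0]. *)
have [p [//]|A [AE sA Amax]] := @max_antichain [set p | C p /\ small_density p].
have [|E EP] := @choice_in V (set V) A (fun p E => (small kappa E /\ E `<=` C) /\
    forall s, ext P s p -> exists2 e, E e & ext P e s).
  by move=> p /AE[_ [E ? ?]]; exists E.
pose D0 := \bigcup_(a in A) E a.
have sD0 : small kappa D0 by apply: small_bigcup => // a /EP[[]].
have DC : (D0 `|` D1) `<=` C.
  by move=> d [[a /EP[[_ EC] _]]|]; [exact: EC | exact: D1C].
have DE := sub_set_vset DC; set D := vsep _ _ in DE.
have memD d : d ∈ D <-> (D0 d \/ D1 d).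
  by have -> : (d ∈ D) = (D0 `|` D1) d by rewrite -DE.
exists D; last first.
  move=> q Cq; apply: (@small_sub _ _ _ (D0 `|` [set d | D1 d /\ ext P q d])).
    by move=> d [/memD[]]; [left|right].
  by apply: small_setU => //; exact: D1s.
split=> [d|p Cp]; first by rewrite DE; exact: DC.
have [np|] := pselect (nowhere_small p).
  by have [d D1d' dp] := D1d p Cp np; exists d => //; apply/memD; right.
move=> /existsNP[r] /not_implyP[rp /contrapT sr].
have [Cr _] := ext_carrier rp.
have [a Aa] := Amax r (conj Cr sr); move=> /contrapT[s [sr' sa]].
have [_ Ed] := EP a Aa; have [e Ee es] := Ed s sa.
exists e; last by apply: ext_trans es (ext_trans sr' rp).
by apply/memD; left; exists a.
Qed.

End Forcing.

(** * Decomposition of closed sets *)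

Section Induction.
Context (kappa : V) (hk : closed_cardinal kappa) (P : poset).
Hypothesis hP : separative P.
Hypothesis hS : forall X, antichain P X -> small kappa (elts X).

Let C := elts (carrier P).
Let op := forcing_op P.
Let op_card := forcing_op_card hk P.

(** The strict size bound of the induction, with a witness large enough to bound closures as
    well. *)
Definition lesser (eta : V) T (Z : set T) : Prop :=
  exists zeta, [/\ zeta ∈ eta, elts kappa #<= elts zeta & Z #<= elts zeta].

Lemma lesser_le eta T U (Y : set T) (Z : set U) :
  Y #<= Z -> lesser eta Z -> lesser eta Y.
Proof.
by move=> YZ [zeta [? ? Zz]]; exists zeta; split=> //; apply: card_le_trans Zz.
Qed.

Lemma sparse_dense_set0 (B : set V) : ~ (B !=set0) -> sparse_dense kappa P B.
Proof.
move=> nB; exists set0 => [d []|].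
by split=> [p Bp|q Bq]; case: nB; [exists p | exists q].
Qed.

Section Step.
Context (eta : V) (ordinal_eta : ordinal_set eta) (kappa_eta : kappa ∈ eta).
Hypothesis IH : forall zeta B, zeta ∈ eta -> forcing_closed kappa P B ->
  B #<= elts zeta -> sparse_dense kappa P B.
Context (B : set V) (Bcl : forcing_closed kappa P B) (Beta : B #<= elts eta).

Lemma lesser_mem i : i ∈ eta -> lesser eta (elts i).
Proof.
move=> ieta.
have [ik|ik|ki] := ordinal_trichotomy (ordinal_mem ordinal_eta ieta) (kappa_ordinal hk).
- by exists kappa; rewrite ik; split=> //; rewrite -ik.
- by exists kappa; split=> //; apply: subset_card_le; apply: (kappa_ordinal hk).1.
- exists i; split=> //; apply: subset_card_le.
  by apply: (ordinal_mem ordinal_eta ieta).1.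
Qed.

Lemma not_lesser (U : pointedType) (K : set U) : ~ lesser eta K -> elts eta #<= K.
Proof.
move=> nK; have [[i ieta Ki]|//] := ordinal_card_le K ordinal_eta.
by case: nK; apply: lesser_le Ki (lesser_mem ieta).
Qed.

Lemma zeta_infinite zeta : elts kappa #<= elts zeta -> [set: nat] #<= elts zeta.
Proof. exact: card_le_trans (kappa_infinite hk). Qed.

Lemma sparse_dense_step_closure :
  (forall Z, Z `<=` B -> lesser eta Z -> lesser eta (pk kappa Z)) ->
  sparse_dense kappa P B.
Proof.
move=> pk_lesser; have [BC Bop] := Bcl.
have [[b0 Bb0]|/sparse_dense_set0//] := pselect (B !=set0).
have [b bB Bb] := card_le_surjE Beta Bb0.
pose upto i : set V := elts i `|` [set i].
pose X i := cl kappa op (b @` upto i).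
have Zsub i : b @` upto i `<=` B by move=> _ [k _ <-].
have XB i : X i `<=` B by apply: cl_min.
have Xcl i : forcing_closed kappa P (X i).
  by apply: forcing_closed_cl; apply: subset_trans BC.
have upto_mono k l : l ∈ eta -> upto l k -> upto k `<=` upto l.
  move=> leta [kl|->//] m [mk|->]; left => //.
  exact: ordinal_trans (ordinal_mem ordinal_eta leta) mk kl.
have X_mono k l : l ∈ eta -> upto l k -> X k `<=` X l.
  by move=> leta kl; apply: cl_mono; apply: image_subset; exact: upto_mono.
have -> : B = \bigcup_(i in elts eta) X i.
  apply/seteqP; split=> [x /Bb[i ieta <-]|x [i _ /XB]//].
  by exists i => //; apply: sub_cl; exists i => //; right.
apply: (sparse_dense_concat hk ordinal_eta) => // [i _|i ieta|i ieta].
- exact: subset_trans (XB i) BC.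
- have [zeta [zeta_eta kz pz]] : lesser eta (pk kappa (b @` upto i)).
    apply: pk_lesser => //; have [zeta [zeta_eta kz iz]] := lesser_mem ieta.
    exists zeta; split=> //; apply: card_le_trans (card_image_le _ _) _.
    apply: setU_card_le => //; first exact: ordinal_mem zeta_eta.
      exact: zeta_infinite.
    exact: card_le_trans (small_card_le (small1 hk i)) kz.
  apply: (IH zeta_eta) => //; apply: cl_card_le => //.
  exact: ordinal_mem zeta_eta.
have oi := ordinal_mem ordinal_eta ieta.
have ieta' k : k ∈ i -> k ∈ eta.
  by move=> ki; exact: ordinal_trans ordinal_eta ki ieta.
(* If [i] has a small cofinal subset, the earlier pieces have the union of the pieces it indexes.
   Otherwise each small subset of their union lies in one piece, so the union is closed and reduces
   by itself. *)
have [[I [sI Ii Icof]]|ncof] := pselect (exists I, [/\ small kappa I,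
    I `<=` elts i & forall k, k ∈ i -> exists2 l, I l & upto l k]).
  exists I, X; split=> // [n _|]; first exact: (closed_reductive hk hP hS).
  apply/seteqP; split=> x [k].
    move=> [_ ki] Xk; have [l Il kl] := Icof k ki; exists l => //.
    by apply: X_mono Xk => //; apply: ieta'; exact: Ii.
  by move=> Ik Xk; exists k => //; split; [apply: ieta'|]; exact: Ii.
exists [set vempty], (fun=> \bigcup_(k in elts eta `&` elts i) X k).
split; [exact: small1| |by rewrite bigcup_set1].
move=> n _; apply: (closed_reductive hk hP hS); split.
  by move=> x [k _ /XB/BC].
move=> y [yY sy].
have [|g gP] := @choice_in V V y (fun c k => k ∈ i /\ X k c).
  by move=> c /yY[k [_ ki] Xk]; exists k.
have [k ki gk] : exists2 k, k ∈ i & forall c, y c -> g c ∈ k.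
  apply: contrapT => nk; apply: ncof; exists (g @` y); split.
  - exact: small_image.
  - by move=> _ [c /gP[? _] <-].
  move=> k ki; apply: contrapT => nl; apply: nk; exists k => // c yc.
  have [gi _] := gP c yc.
  have [gE|//|kg] := ordinal_trichotomy (ordinal_mem oi gi) (ordinal_mem oi ki).
    by case: nl; exists (g c); [exists c | right].
  by case: nl; exists (g c); [exists c | left].
move=> x opx; exists k; first by split=> //; exact: ieta'.
have [_ Xkop] := Xcl k; apply: (Xkop y) => //; split=> // c yc.
by have [_ Xc] := gP c yc; apply: X_mono Xc; [exact: ieta' | left; exact: gk].
Qed.

(** * Filtration of coded sets along the Davies tree *)

Section Trace.
Context (mu : V) (A : V -> set V) (hA : davies_trace kappa mu C A).

Definition before alpha (x : set V) : Prop :=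
  exists2 xi, xi ∈ alpha & x `<=` A xi.

Section Filtration.
Context (zeta : V) (zeta_eta : zeta ∈ eta) (kappa_zeta : elts kappa #<= elts zeta).
Context (alpha1 : V) (ordinal_alpha1 : ordinal_set alpha1).
Hypothesis alpha1_mu : forall a, a ∈ alpha1 -> a ∈ mu.
Context (D : set V) (DC : D `<=` C).
Hypothesis D_before : forall x, pk kappa D x -> before alpha1 x.
Hypothesis before_card : forall a, a ∈ alpha1 ->
  pk kappa D `&` before a #<= elts zeta.
Hypothesis D_big : ~ lesser eta (pk kappa D).

Let ordinal_zeta : ordinal_set zeta := ordinal_mem ordinal_eta zeta_eta.
Let infinite_zeta := zeta_infinite kappa_zeta.

Lemma pk_not_le : ~ (pk kappa D #<= elts zeta).
Proof. by move=> Dz; apply: D_big; exists zeta. Qed.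

(** If [Q] were unbounded, each [x] in [pk kappa D] would, for some [z] in [Q], come before the
    stage [f z] catching [z] or be included in the trace at that stage. That makes at most zeta sets
    [x], against [pk_not_le]. *)
Lemma before_bounded (Q : set (set V)) : Q `<=` pk kappa D ->
  Q #<= elts zeta -> exists2 a, a ∈ alpha1 & forall z, Q z -> before a z.
Proof.
move=> QD Qz; apply: contrapT => na; apply: pk_not_le.
have [A_card _ _] := hA.
have [|f fP] := @choice_in (set V) V Q (fun z xi => xi ∈ alpha1 /\ z `<=` A xi).
  by move=> z /QD/D_before[xi ? ?]; exists xi.
apply: (@card_le_trans _ _ _
  (\bigcup_(z in Q) ((pk kappa D `&` before (f z)) `|` pk kappa (A (f z))))).
  apply: subset_card_le => x Dx; have [xi xia xA] := D_before Dx.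
  have [z Qz' nbz] : exists2 z, Q z & ~ before xi z.
    apply: contrapT => nz; apply: na; exists xi => // z Qz'.
    by apply: contrapT => ?; apply: nz; exists z.
  have [fa zA] := fP z Qz'; exists z => //.
  have [E|xif|fxi] := ordinal_trichotomy (ordinal_mem ordinal_alpha1 xia)
    (ordinal_mem ordinal_alpha1 fa).
  - by right; rewrite -E; split=> //; case: Dx.
  - by left; split=> //; exists xi.
  - by case: nbz; exists (f z).
apply: bigcup_card_le => // z Qz'; have [fa _] := fP z Qz'.
apply: setU_card_le => //; first exact: before_card.
apply: card_le_trans kappa_zeta; apply: pk_card_le => //.
by apply: A_card; exact: alpha1_mu.
Qed.

(** Elements of [B] are coded by small subsets of [D]: [h] decodes, and [g b] is a chosen code of
    [b]. *)
Context (h : set V -> V) (g : V -> set V).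
Hypothesis hB : forall x, B (h x).
Hypothesis gP : forall b, B b -> pk kappa D (g b) /\ h (g b) = b.

(* If Z is closed under [coded_op], then [h @` pk kappa Z] is closed under [op]. *)
Definition coded_op (x : set V) : set V :=
  \bigcup_(y in pk kappa (h @` pk kappa x)) \bigcup_(b in op y) g b.

Lemma op_sub x y : pk kappa (h @` x) y -> op y `<=` B.
Proof.
move=> [yh sy]; have [_ Bop] := Bcl; apply: (Bop y); split=> //.
by move=> _ /yh[z _ <-].
Qed.

Lemma coded_op_card x : small kappa x -> coded_op x #<= elts kappa.
Proof.
move=> [xk _]; apply: kappa_bigcup => // [|y yx].
  apply: pk_card_le => //; apply: card_le_trans (card_image_le _ _) _.
  exact: pk_card_le.
apply: kappa_bigcup => // [|b /(op_sub yx)/gP[[_ []]]//].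
by apply: op_card; case: yx.
Qed.

Let ccl := cl kappa coded_op.

Lemma ccl_sub x : x `<=` D -> ccl x `<=` D.
Proof.
move=> xD; apply: cl_min => // y _ d [w wy [b ob gd]].
by have [[gD _] _] := gP (op_sub wy ob); apply: gD.
Qed.

(** At such a stage the codes seen so far are stable under passing to small subsets of coded
    closures, so the set [level a] they decode to can be cut into closed pieces. *)
Definition coherent a : Prop := a ∈ alpha1 /\
  forall x, pk kappa D x -> before a x ->
    forall z, pk kappa (ccl x) z -> before a z.

Let level a := h @` (pk kappa D `&` before a).

(** Step [s] catches everything generated from an earlier stage, and the supremum [w] of its
    iterates is coherent. It stays below [alpha1], since otherwise [pk kappa D] would be a countable
    union of families of size at most zeta. *)
Lemma coherent_ex x : pk kappa D x -> exists2 a, coherent a & before a x.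
Proof.
move=> Dx.
have [a0 a0a x0] : exists2 a, a ∈ alpha1 & before a x.
  have [||a aa ax] := @before_bounded [set x].
  - by move=> _ ->.
  - apply: card_le_trans kappa_zeta; exact: small_card_le (small1 hk x).
  - by exists a => //; exact: ax.
have [|s sP] := @choice_in V V (elts alpha1) (fun a a' => a' ∈ alpha1 /\
    forall x, pk kappa D x -> before a x ->
      forall z, pk kappa (ccl x) z -> before a' z).
  move=> a aa.
  have [||a' a'a a'P] := @before_bounded
    (\bigcup_(y in pk kappa D `&` before a) pk kappa (ccl y)).
  - move=> z [y [[yD _] _] [zy sz]]; split=> //.
    exact: subset_trans zy (ccl_sub yD).
  - apply: bigcup_card_le => // [|y [[_ sy] _]]; first exact: before_card.
    apply: card_le_trans kappa_zeta; apply: pk_card_le => //.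
    by apply: cl_card_le_kappa => //; [exact: coded_op_card | exact: small_card_le].
  by exists a'; split=> // y Dy ay z zy; apply: a'P; exists y.
pose u n := iter n s a0.
have ua n : u n ∈ alpha1 by elim: n => [//|n IHn]; have [] := sP _ IHn.
pose w := vsep alpha1 [set b | exists n, b ∈ u n].
have memw b : b ∈ w <-> exists n, b ∈ u n.
  have -> : (b ∈ w) = (elts alpha1 `&` [set b | exists n, b ∈ u n]) b.
    by rewrite -elts_vsep.
  split=> [[]//|[n bn]]; split; last by exists n.
  exact: ordinal_trans ordinal_alpha1 bn (ua n).
have ow : ordinal_set w.
  apply: ordinal_vsep => // y z yz za [n zn]; exists n.
  exact: ordinal_trans (ordinal_mem ordinal_alpha1 (ua n)) yz zn.
have before_w y : before w y <-> exists n, before (u n) y.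
  split=> [[b /memw[n bn] yb]|[n [b bn yb]]]; first by exists n; exists b.
  by exists b => //; apply/memw; exists n.
exists w; last by apply/before_w; exists 0%N.
split; last first.
  move=> y Dy /before_w[n yn] z zy; apply/before_w; exists n.+1.
  by have [_ H] := sP _ (ua n); apply: H zy.
have [|E|//] := ordinal_sub ow ordinal_alpha1.
  by move=> b /memw[n bn]; exact: ordinal_trans ordinal_alpha1 bn (ua n).
case: pk_not_le.
apply: (@card_le_trans _ _ _ (\bigcup_(n in [set: nat]) (pk kappa D `&` before (u n)))).
  apply: subset_card_le => y Dy; have := D_before Dy; rewrite -E.
  by move=> /before_w[n yn]; exists n.
by apply: bigcup_card_le => // n _; exact: before_card.
Qed.

(** Each of the few models [N n] with union the stages before [a] gives a piece: the decoded small
    subsets of [ccl x], for small [x] included in [N n]. A small family of such pairs of [x] and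
    code merges into one pair, so the piece is closed under [op]; coherence keeps it inside the
    level. *)
Lemma level_closed_union a : coherent a -> exists (I : set V) (G : V -> set V),
  [/\ small kappa I,
      forall n, I n -> forcing_closed kappa P (G n) /\ G n #<= elts zeta &
      level a = \bigcup_(n in I) G n].
Proof.
move=> [aa acoh]; have [_ _ /(_ a (alpha1_mu aa))] := hA.
move=> [NN [N [sNN NP]]].
have pkDC x : pk kappa D x -> pk kappa C x by apply: pk_mono.
pose G n := h @` [set z | exists x, [/\ pk kappa D x, x `<=` N n & pk kappa (ccl x) z]].
have Glev n : NN n -> G n `<=` level a.
  move=> NNn _ [z [x [Dx xN zx]] <-]; exists z => //; split.
    by have [xD _] := Dx; have [zx' sz] := zx; split=> //; apply: subset_trans (ccl_sub xD).
  by apply: (acoh x) => //; apply/(NP x (pkDC x Dx)); exists n.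
exists NN, G; split=> // [n NNn|]; last first.
  apply/seteqP; split=> [_ [z [Dz az] <-]|b [n NNn]]; last exact: Glev.
  have [n NNn zn] := (NP z (pkDC z Dz)).1 az.
  exists n => //; exists z => //; exists z; split=> //.
  by have [_ sz] := Dz; split=> //; exact: sub_cl.
split; last first.
  apply: card_le_trans (subset_card_le (Glev n NNn)) _.
  exact: card_le_trans (card_image_le _ _) (before_card aa).
have [BC _] := Bcl; split=> [_ [z _ <-]|y [yG sy] b opb]; first exact: BC.
have [|f fP] := @choice_in V (set V * set V)%type y (fun b p =>
    [/\ h p.2 = b, pk kappa D p.1, p.1 `<=` N n & pk kappa (ccl p.1) p.2]).
  by move=> _ /yG[z [x [? ? ?]] <-]; exists (x, z).
pose x := \bigcup_(c in y) (f c).1; pose z := \bigcup_(c in y) (f c).2.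
have Dx : pk kappa D x.
  split=> [d [c /fP[_ [fD _] _ _] fd]|]; first exact: fD.
  by apply: small_bigcup => // c /fP[_ []].
have zx : pk kappa (ccl x) z.
  split; last by apply: small_bigcup => // c /fP[_ _ _ []].
  move=> d [c yc fd]; have [_ _ _ [sub _]] := fP c yc.
  by apply: (@cl_mono _ _ (f c).1) (sub d fd) => e fe; exists c.
have yz : pk kappa (h @` pk kappa z) y.
  split=> // c yc; have [hc _ _ [_ sc]] := fP c yc; exists (f c).2 => //.
  by split=> // d fd; exists c.
have [[gD sg] hg] := gP (op_sub yz opb).
exists (g b) => //; exists x; split=> //.
  by move=> d [c /fP[_ _ fN _] fd]; exact: fN.
split=> // d gd; apply: (@closed_cl _ coded_op x z zx).
by exists y => //; exists b.
Qed.

Lemma sparse_dense_coded : sparse_dense kappa P B.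
Proof.
have [BC _] := Bcl.
have levelC a : level a `<=` C by move=> _ [x _ <-]; exact: BC.
have -> : B = \bigcup_(a in coherent) level a.
  apply/seteqP; split=> [b Bb|_ [a _ [x _ <-]]] //.
  have [Dg hg] := gP Bb; have [a ca ag] := coherent_ex Dg.
  by exists a => //; exists (g b).
apply: (sparse_dense_concat hk ordinal_alpha1) => // [a []//|a ca|a ca].
  have [I [G [sI Gcl ->]]] := level_closed_union ca.
  apply: (sparse_dense_small hk) => // n /Gcl[[GC Gop] Gz] //.
    by apply: (closed_reductive hk hP hS); split.
  by apply: (IH zeta_eta).
have [aa _] := ca.
(* The supremum of the coherent stages below [a] is again coherent, and its level is the union of
   the earlier levels. *)
pose w := vsep alpha1 [set b | exists2 c, coherent c /\ c ∈ a & b ∈ c].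
have memw b : b ∈ w <-> exists2 c, coherent c /\ c ∈ a & b ∈ c.
  have -> : (b ∈ w) = (elts alpha1 `&`
      [set b | exists2 c, coherent c /\ c ∈ a & b ∈ c]) b.
    by rewrite -elts_vsep.
  split=> [[]//|[c [cc ca'] bc]]; split; last by exists c.
  by apply: ordinal_trans ordinal_alpha1 bc _; case: cc.
have before_w y : before w y <-> exists2 c, coherent c /\ c ∈ a & before c y.
  split=> [[b /memw[c cc bc] yb]|[c cc [b bc yb]]]; first by exists c => //; exists b.
  by exists b => //; apply/memw; exists c.
have oa := ordinal_mem ordinal_alpha1 aa.
have ow : ordinal_set w.
  apply: ordinal_vsep => // y z yz za [c [cc ca'] zc]; exists c => //.
  exact: ordinal_trans (ordinal_mem oa ca') yz zc.
have cw : coherent w.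
  split.
    have [|->//|wa] := ordinal_sub ow oa.
      by move=> b /memw[c [_ ca'] bc]; exact: ordinal_trans oa bc ca'.
    exact: ordinal_trans ordinal_alpha1 wa aa.
  move=> y Dy /before_w[c cc yc] z zy; apply/before_w; exists c => //.
  by have [[_ H] _] := cc; apply: H zy.
have -> : \bigcup_(k in coherent `&` elts a) level k = level w.
  apply/seteqP; split=> [_ [c cc [x [Dx cx] <-]]|_ [x [Dx /before_w[c cc cx]] <-]].
    by exists x => //; split=> //; apply/before_w; exists c.
  by exists c => //; exists x.
have [I [G [sI Gcl ->]]] := level_closed_union cw.
exists I, G; split=> // n /Gcl[? _]; exact: (closed_reductive hk hP hS).
Qed.

End Filtration.
Lemma sparse_dense_step_trace zeta (Z : set V) : ordinal_set mu ->
  zeta ∈ eta -> elts kappa #<= elts zeta -> Z `<=` C -> Z #<= elts zeta ->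
  ~ lesser eta (pk kappa Z) -> sparse_dense kappa P B.
Proof.
move=> omu zeta_eta kz ZC Zz Zbig.
have oz := ordinal_mem ordinal_eta zeta_eta; have infz := zeta_infinite kz.
have [A_card A_cov A_init] := hA.
have nZz : ~ (pk kappa Z #<= elts zeta) by move=> ?; apply: Zbig; exists zeta.
have pkZC x : pk kappa Z x -> pk kappa C x by apply: pk_mono.
(* The first stage, possibly [mu] itself, before which more than zeta small subsets of [Z] are
   caught. *)
have [|a1 [a1mu na1] a1min] := @vmem_min [set a | (a ∈ mu \/ a = mu) /\
    ~ (pk kappa Z `&` before a #<= elts zeta)] mu.
  split=> [|Zle]; first by right.
  apply: nZz; apply: card_le_trans Zle; apply: subset_card_le => x Zx.
  by split=> //; have [a amu xa] := A_cov x (pkZC x Zx); exists a.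
have oa1 : ordinal_set a1 by case: a1mu => [/(ordinal_mem omu)|->].
have a1_sub a : a ∈ a1 -> a ∈ mu.
  by move=> aa1; case: a1mu => [a1mu|<-//]; exact: ordinal_trans omu aa1 a1mu.
have before_le a : a ∈ a1 -> pk kappa Z `&` before a #<= elts zeta.
  move=> aa1; apply: contrapT => nle; apply: (a1min a aa1); split=> //.
  by left; exact: a1_sub.
(* Below [mu], the sets caught before [a1] split among fewer than kappa sets [Z] intersected with
   [N n], one of which must have more than zeta small subsets. *)
have [D [DZ D_before nDz]] : exists D, [/\ D `<=` Z,
    forall x, pk kappa D x -> before a1 x & ~ (pk kappa D #<= elts zeta)].
  case: a1mu => [a1mu|a1E]; last first.
    exists Z; split=> // x /pkZC Zx.
    by rewrite a1E; have [a amu xa] := A_cov x Zx; exists a.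
  have [NN [N [sNN NP]]] := A_init a1 a1mu.
  apply: contrapT => nD; apply: na1.
  apply: (@card_le_trans _ _ _ (\bigcup_(n in NN) pk kappa (Z `&` N n))).
    apply: subset_card_le => x [Zx /(NP x (pkZC x Zx))[n NNn xN]].
    by exists n => //; have [xZ sx] := Zx; split=> // d xd; split; auto.
  apply: bigcup_card_le => // [|n NNn].
    exact: card_le_trans (small_card_le sNN) kz.
  apply: contrapT => nle; apply: nD; exists (Z `&` N n); split=> // x xD.
  have xZ : pk kappa Z x by apply: pk_mono xD => d [].
  apply/(NP x (pkZC x xZ)); exists n => //.
  by have [xZN _] := xD => d /xZN[].
(* As [Z] injects into [pk kappa D], each small subset of [Z] is determined inside a single small
   subset [U] of [D], and at most kappa of them share the same [U]. So a bound on [pk kappa D] would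
   bound [pk kappa Z]. *)
have D_big : ~ lesser eta (pk kappa D).
  move=> [zeta' [zeta'_eta kz' Dz']]; apply: Zbig; exists zeta'; split=> //.
  have [[i iz Di]|zD] := ordinal_card_le (pk kappa D) oz.
    case: nDz; apply: card_le_trans Di _; apply: subset_card_le; exact: oz.1.
  have [f fD finj] := card_le_injE (card_le_trans Zz zD).
  apply: (@card_le_trans _ _ _
    (\bigcup_(U in pk kappa D) pk kappa [set c | Z c /\ f c `<=` U])).
    apply: subset_card_le => x [xZ sx]; exists (\bigcup_(c in x) f c).
      split=> [d [c /xZ/fD[fcD _]]|]; first exact: fcD.
      by apply: small_bigcup => // c /xZ/fD[].
    by split=> // c xc; split; [exact: xZ | move=> d fd; exists c].
  apply: bigcup_card_le => // [||U [_ sU]]; first exact: ordinal_mem zeta'_eta.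
    exact: zeta_infinite.
  apply: card_le_trans kz'; apply: pk_card_le => //.
  apply: card_le_trans (pk_card_le hk (small_card_le sU)).
  apply: (@card_le_inj _ _ _ _ f) => [c [Zc fU]|c d [Zc _] [Zd _]].
    by split=> //; have [] := fD c Zc.
  exact: finj.
have [[b0 Bb0]|/sparse_dense_set0//] := pselect (B !=set0).
have [h hB Bh] := card_le_surjE (card_le_trans Beta (not_lesser D_big)) Bb0.
have [|g gP] := @choice_in V (set V) B (fun b x => pk kappa D x /\ h x = b).
  by move=> b /Bh[x ? ?]; exists x.
have DC : D `<=` C by apply: subset_trans ZC.
apply: (sparse_dense_coded zeta_eta kz oa1 a1_sub DC D_before _ D_big hB gP).
move=> a aa1; apply: card_le_trans (before_le a aa1).
by apply: subset_card_le => x [xD ax]; split=> //; apply: pk_mono xD.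
Qed.

End Trace.
End Step.

Lemma sparse_dense_all mu A eta B : ordinal_set mu ->
  davies_trace kappa mu C A -> ordinal_set eta -> forcing_closed kappa P B ->
  B #<= elts eta -> sparse_dense kappa P B.
Proof.
move=> omu hA; elim/(well_founded_ind vmem_wf): eta B => eta IH B oeta Bcl Beta.
have [Bk|nBk] := pselect (B #<= elts kappa); first exact: sparse_dense_kappa.
have keta : kappa ∈ eta.
  have ok := kappa_ordinal hk.
  apply: contrapT => /(ordinal_nmem ok oeta)/subset_card_le etak.
  by apply: nBk; apply: card_le_trans etak.
have {}IH zeta B' : zeta ∈ eta -> forcing_closed kappa P B' ->
    B' #<= elts zeta -> sparse_dense kappa P B'.
  by move=> ze; apply: IH => //; exact: ordinal_mem ze.
have [pkl|] := pselect (forall Z, Z `<=` B -> lesser eta Z -> lesser eta (pk kappa Z)).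
  exact: (sparse_dense_step_closure oeta).
move=> /existsNP[Z] /not_implyP[ZB] /not_implyP[[zeta [ze kz Zz]] nZ].
have [BC _] := Bcl.
have ZC := subset_trans ZB BC.
exact: (sparse_dense_step_trace oeta keta IH Bcl Beta hA omu ze kz ZC Zz nZ).
Qed.

End Induction.

(** * The pi-Noetherian type *)

Lemma least_cardinalP (Q : set V) k : cardinal k -> Q k ->
  least_cardinal Q (min_cardinal Q).
Proof.
move=> kc Qk; apply: getPex.
have [l [lc Ql] lmin] := @vmem_min [set l | cardinal l /\ Q l] k (conj kc Qk).
exists l; split=> // m mc Qm; apply: ordinal_nmem; [exact: mc.1 | exact: lc.1 |].
by move=> ml; apply: (lmin m ml).
Qed.

Lemma pint_sub (P : poset) (D kappa : V) : cardinal kappa -> dense P D ->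
  (forall q, q ∈ carrier P -> small kappa [set d | d ∈ D /\ ext P q d]) ->
  pint P ⊆ kappa.
Proof.
move=> kc Dd Ds.
have [ntc _ ntmin] := @least_cardinalP [set k | forall q, q ∈ carrier P ->
  [set p | p ∈ D /\ ext P q p] #< elts k] kappa kc Ds.
have [||_ _ pmin] := @least_cardinalP [set k | exists2 D, dense P D & nt P D = k]
  (nt P D) => //; first by exists D.
apply: subset_trans (pmin _ ntc _) (ntmin _ kc Ds).
by exists D.
Qed.

(** The cardinal [theta] of the tree exceeds the size of [mu], hence of all antichains, so the
    minimum defining [souslin P] is taken over a nonempty class. *)
Lemma souslin_spec (P : poset) kappa mu p M : souslin P = kappa ->
  elts (carrier P) #<= elts mu -> davies_tree kappa mu p M ->
  cardinal kappa /\ forall X, antichain P X -> small kappa (elts X).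
Proof.
move=> <- Pmu [theta [[tc _ _] [_ Hmu _] _ _ _]].
have [|kc kX _] := @least_cardinalP
  [set k | forall X, antichain P X -> elts X #< elts k] theta tc => //.
move=> X [XP _]; apply: small_le (card_le_trans (subset_card_le XP) Pmu) _.
by apply: small_sub Hmu => z zmu; apply: Relation_Operators.t_step.
Qed.

Lemma elts_vempty : elts vempty = set0.
Proof. by apply/seteqP; split=> // x /mem_vfam[]. Qed.

(** Smallness of a singleton makes kappa exceed 1, so that it has a nonempty element. Covering the
    empty set provides a model of the tree. *)
Lemma davies_tree_closed_cardinal kappa mu x M T (p : T) :
  cardinal kappa -> small kappa [set p] -> davies_tree kappa mu x M ->
  closed_cardinal kappa.
Proof.
move=> kc [_ nk] [theta [_ _ Mcl Mcov _]]; split=> //.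
  apply: contrapT => nc; apply: nk.
  apply: (@card_le_inj _ _ _ _ (fun=> p)) => // y z yk zk _.
  have mem0 c : c ∈ kappa -> elts c = set0.
    move=> ck; apply/seteqP; split=> // d dc; apply: nc.
    by exists c; split=> //; exists d.
  by apply: vext; rewrite !mem0.
have [||a amu _] := Mcov vempty; first by rewrite elts_vempty.
  rewrite elts_vempty; split=> // k0; apply: nk.
  by apply: card_le_trans k0 _; apply: card_ge0.
by exists (M a); have [_ _ ? ?] := Mcl a amu.
Qed.

Theorem theorem3p3 (P : poset) (hP : separative P)
    (kappa : V) (hkappa : souslin P = kappa)
    (hD : exists mu, [/\ cardinal mu, (elts (carrier P) #<= elts mu) &
            exists M : V -> V, davies_tree kappa mu (poset_set P) M]) :
  pint P ⊆ souslin P.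
Proof.
case: hD => mu [muc Pmu [M hM]]; rewrite hkappa.
have [kc hS] := souslin_spec hkappa Pmu hM.
have [[p Cp]|nC] := pselect (elts (carrier P) !=set0); last first.
  (* With an empty carrier the empty set is dense and the bounds hold vacuously. *)
  apply: (@pint_sub P vempty) => // [|q qP]; last by case: nC; exists q.
  split=> [x|q qP]; first by rewrite elts_vempty.
  by case: nC; exists q.
have hk : closed_cardinal kappa.
  apply: (@davies_tree_closed_cardinal kappa mu _ M _ p kc _ hM).
  (* The singleton of [p] is an antichain, hence small. *)
  have pE : elts (vpair p p) = [set p].
    apply/seteqP; split=> x; first by move=> /mem_vpair[].
    by move=> ->; apply/mem_vpair; left.
  have memp x : x ∈ vpair p p -> x = p by move=> /mem_vpair[].
  rewrite -pE; apply: hS; split=> [x /memp->//|x y /memp-> /memp->//].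
have [A hA] := davies_tree_trace hk muc Pmu hM.
have Csd := sparse_dense_all hk hP hS muc.1 hA muc.1
  (@forcing_closed_carrier kappa P) Pmu.
have [D Dd Ds] := sparse_dense_total hk hS Csd.
exact: pint_sub kc Dd Ds.
Qed.
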